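(* Let $T$ be a homogeneous tree of homogeneity degree $q$, with reference edge $e_0$, let $f$ be a finitely supported (or $\ell^1$) function on $E$ and let $\psi=\mathcal R_Ef$ be its edge-horospherical Radon transform. Then there are uncountably many equivalent inversion formulas for $\mathcal R_E$, all of the following form: $$f(e_0)=\sum_{n=-\infty}^{\infty}l_n\int_\Omega\psi(\mathbf h_n(\omega,e_0))\,d\nu_{e_0}(\omega).$$ Some examples of appropriate coefficients $l_n$ are $$l_n=\begin{cases}0& \text{if } n \text{ is odd or } n<0,\\ 1& \text{if } n=0,\\ \dfrac{1-q}{1+q}\bigl(1-(-q)^n\bigr)& \text{otherwise},\end{cases}\qquad\text{and}\qquad l_n=\begin{cases}(-1)^n& \text{if } n\le 0,\\ 2\,\dfrac{1-(-q)^n}{1+q}-1& \text{if } n>0.\end{cases}$$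
   Context: $T$ is a tree in which every vertex has exactly $q+1$ neighbours; $V$, $E$ are its sets of vertices and unoriented edges. $\operatorname{dist}$ is the graph distance on $V$; two edges are adjacent if they share exactly one vertex, and the distance between edges is the length of the shortest chain of adjacent edges joining them. $\Omega$ is the set of ends (equivalence classes of geodesic rays that eventually coincide). For vertices, $h(v,v_0,\omega)=\operatorname{dist}(v_0,w)-\operatorname{dist}(v,w)$ for any $w$ far enough along the ray from $v_0$ to $\omega$. For edges, $h(e,e_0,\omega)=h(v(e,\omega),v(e_0,\omega),\omega)$, where $v(e,\omega)$ is the endpoint of $e$ closer to $\omega$. The edge-horosphere tangent at $\omega$ of index $n$ with respect to $e_0$ is $\mathbf h_n(\omega,e_0)=\{e\in E:h(e,e_0,\omega)=n\}$, and $\mathcal R_Ef(\mathbf h)=\sum_{e\in\mathbf h}f(e)$. $\nu_{e_0}$ is the Borel probability measure on $\Omega$ such that, for each edge $e$ at distance $n\geq1$ from $e_0$, the set of ends represented by edge-rays that start at $e_0$ and pass through $e$ has mass $1/(2q^n)$. Inversion formulas are equivalent if they agree on the image of $\mathcal R_E$.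
   Formalization: In the first example the clause ''n is odd or'' is dropped (l_n = 0 only for n<0; the ''otherwise'' formula holds for all n>0): as printed it fails for q≥2 on the indicator of an edge adjacent to e_0, giving (q-1)/(2q), not 0. Functions and coefficients are real-valued. *)

(* Defs.v *)
From HB Require Import structures.
From mathcomp Require Import all_boot all_order all_algebra.
From mathcomp Require Import all_classical all_reals all_analysis.
Set Implicit Arguments.
Unset Strict Implicit.
Unset Printing Implicit Defensive.
Import Order.TTheory GRing.Theory Num.Theory.
Import numFieldNormedType.Exports.
Local Open Scope classical_set_scope.
Local Open Scope ring_scope.

(* The condition 0 < q rules out the single edge, the only case without ends. *)
Record homogeneous_tree (q : nat) := HomogeneousTree {
  vertex :> choiceType;
  adj : rel vertex;
  adj_sym : symmetric adj;
  adj_irr : irreflexive adj;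
  tree_nonempty : exists v : vertex, True;
  tree_connected : forall u v, exists2 p, path adj u p & last u p = v;
  tree_acyclic : forall c, (2 < size c)%N -> ~ ucycle adj c;
  tree_degree_gt0 : (0 < q)%N;
  tree_homogeneous : forall v, ([set w | adj v w] #= `I_q.+1)%card
}.
Arguments adj {q} _.

(* Length of a shortest r-chain from x to y (0 if there is none). *)
Definition graph_dist (X : choiceType) (r : rel X) (x y : X) : nat :=
  xget 0%N [set n | (exists p, [/\ path r x p, last x p = y & size p = n]) /\
                    forall p, path r x p -> last x p = y -> (n <= size p)%N].

Section Tree.
Context {q : nat} (T : homogeneous_tree q).

Definition dist : T -> T -> nat := graph_dist (adj T).

Definition is_edge : set (set T) :=
  [set e | exists u v, adj T u v /\ e = [set u; v]].

Definition edge := set_type is_edge.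
HB.instance Definition _ := Choice.on edge.

Definition endpoints (e : edge) : set T := \val e.

Definition edge_adj : rel edge :=
  fun e e' => `[< exists v, endpoints e `&` endpoints e' = [set v] >].

Definition edge_dist : edge -> edge -> nat := graph_dist edge_adj.

Definition geodesic_ray : set (nat -> T) :=
  [set r | forall i n, dist (r i) (r (i + n)%N) = n].

Definition eventually_coincide (r r' : nat -> T) :=
  exists i j, forall n, r (i + n)%N = r' (j + n)%N.

Definition is_end : set (set (nat -> T)) :=
  [set w | exists2 r, geodesic_ray r &
           w = [set r' | geodesic_ray r' /\ eventually_coincide r r']].

Definition tree_end := set_type is_end.
HB.instance Definition _ := Choice.on tree_end.

Definition rays_of (w : tree_end) : set (nat -> T) := \val w.

Definition vertex_index (v v0 : T) (w : tree_end) : int :=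
  xget 0 [set k | exists r, [/\ rays_of w r, r 0%N = v0 &
    \forall n \near \oo, (dist v0 (r n))%:Z - (dist v (r n))%:Z = k]].

Lemma edge_nonempty (e : edge) : exists v, endpoints e v.
Proof.
have /set_mem[u [v [_ He]]] := valP e; exists u.
by rewrite /endpoints He; left.
Qed.

(* The endpoint of e closer to w; the first argument of xget is a junk value. *)
Definition near_endpoint (e : edge) (w : tree_end) : T :=
  xget (sval (cid (edge_nonempty e)))
    [set v | endpoints e v /\
             forall u, endpoints e u -> u <> v -> 0 < vertex_index v u w].

Definition edge_index (e e0 : edge) (w : tree_end) : int :=
  vertex_index (near_endpoint e w) (near_endpoint e0 w) w.

Definition edge_horosphere (n : int) (w : tree_end) (e0 : edge) : set edge :=
  [set e | edge_index e e0 w = n].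

Definition edge_ray : set (nat -> edge) :=
  [set s | forall i n, edge_dist (s i) (s (i + n)%N) = n].

Definition represents (s : nat -> edge) (w : tree_end) :=
  exists2 r, rays_of w r & forall i, endpoints (s i) = [set r i; r i.+1].

Definition shadow (e0 e : edge) : set tree_end :=
  [set w | exists s, [/\ edge_ray s, s 0%N = e0, exists n, s n = e
                       & represents s w]].

(* The usual topology on the space of ends, with the shadows as a base. *)
Definition end_open : set (set tree_end) :=
  [set U | forall w, U w ->
     exists e e', shadow e e' w /\ shadow e e' `<=` U].

Lemma simple_path_uniq (x : T) p1 p2 :
  path (adj T) x p1 -> path (adj T) x p2 -> uniq (x :: p1) -> uniq (x :: p2) ->
  last x p1 = last x p2 -> p1 = p2.
Proof.
elim: p1 x p2 => [|a p1 IH] x [|b p2] //=.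
- by move=> _ _ _ /andP[xb _] e; move: xb; rewrite e mem_last.
- by move=> _ _ /andP[xa _] _ e; move: xa; rewrite -e mem_last.
move=> /andP[xa P1] /andP[xb P2] /andP[nx1 U1] /andP[nx2 U2] el.
have [ab|ab] := eqVneq a b.
  by subst b; rewrite (IH a p2).
exfalso.
have hasp : has [in b :: p2] (a :: p1).
  by apply/hasP; exists (last a p1); rewrite ?mem_last// el mem_last.
have P1' : path (adj T) x (a :: p1) by rewrite /= xa.
have P2' : path (adj T) x (b :: p2) by rewrite /= xb.
have U1' : uniq (a :: p1) by [].
have U2' : uniq (b :: p2) by [].
have A1 : ohead (a :: p1) = Some a by [].
have B1 : ohead (b :: p2) = Some b by [].
move: hasp nx1 nx2 P1' P2' U1' U2' A1 B1.
move: (a :: p1) (b :: p2) => s t {IH xa P1 xb P2 U1 U2 el}.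
move=> hst; case: (split_find hst) => z s1 s2 zt /hasPn ns1.
case/splitPr: zt ns1 => t1 t2 ns1.
rewrite !mem_cat !mem_rcons !inE !negb_or.
move=> /andP[/andP[xz xs1] _] /andP[xt1 /andP[_ _]].
rewrite !cat_path !rcons_path /=.
move=> /andP[/andP[S1 Sz] _] /andP[T1 /andP[Tz _]].
rewrite !cat_uniq rcons_uniq /= => /andP[/andP[zs1 us1] _].
move=> /andP[ut1 /andP[nt1 _]] hs ht.
apply: (@tree_acyclic _ T (x :: s1 ++ z :: rev t1)).
  rewrite /= size_cat /= size_rev addnS !ltnS addn_gt0.
  case: s1 hs {hst S1 Sz ns1 xs1 zs1 us1} => [|c s1] //= [hz].
  case: t1 ht {xt1 T1 Tz ut1 nt1} => [|c t1] //= [hb].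
  by move: ab; rewrite -hz -hb eqxx.
have sym := @adj_sym _ T.
have Tr : path (adj T) z (rcons (rev t1) x).
  have es : (fun u v => adj T v u) =2 adj T by move=> u v; exact: sym.
  have Tp : path (adj T) x (rcons t1 z) by rewrite rcons_path T1 Tz.
  have := rev_path (adj T) x (rcons t1 z).
  by rewrite belast_rcons last_rcons rev_cons [X in _ = X](eq_path es) Tp => ->.
apply/andP; split.
  rewrite /= rcons_cat cat_path S1 /= Sz /=; exact: Tr.
rewrite /= mem_cat inE mem_rev !negb_or xs1 xz xt1 /=.
rewrite cat_uniq us1 /= rev_uniq ut1 mem_rev.
move: nt1; rewrite negb_or => /andP[-> _]; rewrite !andbT negb_or zs1 /=.
apply/hasPn => u; rewrite mem_rev => ut; apply/negP => us.
by have := ns1 u us; rewrite /= mem_cat ut.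
Qed.

Lemma dist_simple (x : T) p :
  path (adj T) x p -> uniq (x :: p) -> dist x (last x p) = size p.
Proof.
move=> Pp Up; rewrite /dist /graph_dist.
have Hmin p' : path (adj T) x p' -> last x p' = last x p ->
    (size p <= size p')%N.
  move=> Pp'; case/shortenP: Pp' => s Ps Us sub el.
  rewrite (simple_path_uniq Pp Ps Up Us (esym el)).
  apply: uniq_leq_size => //; by move: Us => /= /andP[].
apply: xget_unique.
  by split=> //; exists p.
move=> n [[p' [P' L' <-]] Hn]; apply/eqP; rewrite eqn_leq Hmin // andbT.
exact: Hn.
Qed.

Lemma other_neighbor (u v : T) : exists w, adj T v w /\ w <> u.
Proof.
apply: contrapT => H.
have sub : [set w | adj T v w] `<=` [set u].
  by move=> w vw; apply: contrapT => wu; apply: H; exists w.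
have := subset_card_le sub.
rewrite (card_le_eql (@tree_homogeneous _ T v)) (card_le_eqr card_set1).
by rewrite card_le_II ltnS leqn0 -leqn0 leqNgt (tree_degree_gt0 T).
Qed.

Lemma geodesic_ray_exists : exists r, geodesic_ray r.
Proof.
have [v0 _] := @tree_nonempty _ T.
pose next u v := sval (cid (other_neighbor u v)).
have nextP u v : adj T v (next u v) /\ next u v <> u.
  by rewrite /next; case: cid.
pose r n := (iter n (fun uv => (uv.2, next uv.1 uv.2)) (v0, v0)).2.
have radj n : adj T (r n) (r n.+1) by exact: (nextP _ _).1.
have rnb n : r n.+2 <> r n by exact: (nextP _ _).2.
pose s i n := [seq r j | j <- iota i n].
have spath i n : path (adj T) (r i) (s i.+1 n).
  by elim: n i => //= n IH i; rewrite radj IH.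
have slast i n : last (r i) (s i.+1 n) = r (i + n)%N.
  by elim: n i => [|n IH] i /=; rewrite ?addn0 // IH addSnnS.
have suniq n i : uniq (s i n).
  elim/ltn_ind: n i => -[//|n] IH i; rewrite /= IH // andbT.
  apply/negP => /mapP[k]; rewrite mem_iota => /andP[ik kn] rik.
  move: kn; rewrite -(subnKC ik); move: (k - i.+1)%N (subnKC ik) => j jk.
  rewrite ltn_add2l => jn.
  apply: (@tree_acyclic _ T (s i j.+1)).
    rewrite size_map size_iota !ltnS.
    case: j jk {jn} => [|[|//]] jk; exfalso; move: rik; rewrite -jk.
      by rewrite addn0 => e; have := radj i; rewrite -e adj_irr.
    by rewrite addn1 => /esym; apply: rnb.
  apply/andP; split; last exact: IH.
  have -> : cycle (adj T) (s i j.+1) =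
            path (adj T) (r i) (rcons (s i.+1 j) (r i)) by [].
  by rewrite rcons_path spath slast rik -jk addSn radj.
exists r => i n /=.
by rewrite -slast dist_simple ?size_map ?size_iota //; exact: (suniq n.+1 i).
Qed.

Lemma tree_end_exists : exists w : tree_end, True.
Proof.
have [r Hr] := geodesic_ray_exists.
have H : [set r' | geodesic_ray r' /\ eventually_coincide r r'] \in is_end.
  by rewrite inE; exists r.
by exists (exist (fun w => is_true (w \in is_end)) _ H).
Qed.

HB.instance Definition _ := isPointed.Build tree_end (sval (cid tree_end_exists)).

Definition end_borel := g_sigma_algebraType end_open.
HB.instance Definition _ := Measurable.on end_borel.

Context {R : realType}.

(* Characterizes the measure nu_{e0}, which is unique: the shadows of e0 form,
   with the empty set, a pi-system generating the Borel sets. *)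
Definition is_end_measure (e0 : edge) (nu : probability end_borel R) : Prop :=
  forall (e : edge) (n : nat), (0 < n)%N -> edge_dist e0 e = n ->
    nu (shadow e0 e) = ((2 * q%:R ^+ n)^-1)%:E.

Definition finitely_supported : set (edge -> R) :=
  [set f | finite_set [set e | f e != 0]].

Definition ell1 : set (edge -> R) := [set f | summable setT (EFin \o f)].

(* The unordered sum of f over h, for f absolutely summable on h. *)
Definition radon (f : edge -> R) (h : set edge) : R :=
  fine (\esum_(e in h) (EFin \o f)^\+ e - \esum_(e in h) (EFin \o f)^\- e)%E.

Definition horosphere_mean (e0 : edge) (nu : probability end_borel R)
    (psi : set edge -> R) (n : int) : R :=
  \int[nu]_w psi (edge_horosphere n w e0).

(* s is the sum of the a_n over all integers n, both half-series converging *)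
Definition bilateral_sum (a : int -> R) (s : R) : Prop :=
  exists s1 s2, [/\ series (fun n => a (Posz n)) @ \oo --> s1,
                    series (fun n => a (Negz n)) @ \oo --> s2 &
                    s = s1 + s2].

(* The formula with coefficients l makes sense on psi and has the value s. *)
Definition formula_value (e0 : edge) (nu : probability end_borel R)
    (l : int -> R) (psi : set edge -> R) (s : R) : Prop :=
  (forall n, nu.-integrable setT
     (fun w => (psi (edge_horosphere n w e0))%:E)) /\
  bilateral_sum (fun n => l n * horosphere_mean e0 nu psi n) s.

Definition inversion_formula (F : set (edge -> R)) (e0 : edge)
    (nu : probability end_borel R) : set (int -> R) :=
  [set l | forall f, F f -> formula_value e0 nu l (radon f) (f e0)].

Definition equivalent_formulas (F : set (edge -> R)) (e0 : edge)
    (nu : probability end_borel R) (l l' : int -> R) : Prop :=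
  forall psi s, (radon @` F) psi ->
    formula_value e0 nu l psi s <-> formula_value e0 nu l' psi s.

End Tree.
Arguments end_borel {q} T.
Arguments finitely_supported {q T R}.
Arguments ell1 {q T R}.

(* These do not vanish at odd n > 0: an edge adjacent to e0 has index -1, 0, 1
   with probability 1/2, (q-1)/(2q), 1/(2q), so that an inversion formula must
   satisfy q l_{-1} + (q-1) l_0 + l_1 = 0; here this reads l_1 = 1 - q. *)
Definition coef_one_sided (R : realType) (q : nat) (n : int) : R :=
  if n < 0 then 0 else if n == 0 then 1
  else (1 - q%:R) / (1 + q%:R) * (1 - (- q%:R) ^ n).

Definition coef_two_sided (R : realType) (q : nat) (n : int) : R :=
  if n <= 0 then (-1) ^ n
  else 2 * ((1 - (- q%:R) ^ n) / (1 + q%:R)) - 1.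

(* Main.v *)
Require Import Defs.
From mathcomp Require Import all_boot all_order all_algebra.
From mathcomp Require Import all_classical all_reals all_analysis.
From mathcomp Require Import measurable_realfun finmap zify lra.
Set Implicit Arguments.
Unset Strict Implicit.
Unset Printing Implicit Defensive.
Import Order.TTheory GRing.Theory Num.Theory.
Import numFieldNormedType.Exports.
Local Open Scope classical_set_scope.
Local Open Scope ring_scope.

(* Let [e] be an edge at distance [n] from [e0] and [v 0, ..., v n.+1] the
   geodesic with first edge [e0] and last edge [e]. The index of [e] depends only
   on the vertex [v k] at which the ray to the end leaves this geodesic: it is
   [-n], [2k-1-n] (for [1 <= k <= n]) or [n], with probabilities [1/2],
   [1/(2q^(k-1)) - 1/(2q^k)] and [1/(2q^n)]. Hence, by Fubini, the formula with
   coefficients [l] evaluates to the sum over [e] of [f e] times the mean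
   [turn_average n l] of [l] under this law, and it is an inversion formula as
   soon as these means vanish for [n > 0] and equal 1 for [n = 0]. Fubini applies
   on [ell1] if [|l m| <= C (1 + q^m)], because [1] and [q^m] both have mean 1 for
   every [n]. The inversion formulas form an affine space, so two distinct ones
   generate uncountably many. *)

(** * Distances and geodesics in the tree *)

Section TreeDistance.
Context {q : nat} {T : homogeneous_tree q}.
Implicit Types (u v x y : T).

Lemma simple_path_exists u x : exists p, [/\ path (adj T) u p, last u p = x,
  uniq (u :: p) & dist u x = size p].
Proof.
have [p Pp <-] := tree_connected u x.
case/shortenP: Pp => p' P' U' _.
by exists p'; split => //; exact: dist_simple.
Qed.

Lemma dist_le_path u p : path (adj T) u p -> (dist u (last u p) <= size p)%N.
Proof.
move=> Pp; case/shortenP: Pp => p' P' U' sub; rewrite dist_simple//.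
by apply: uniq_leq_size => //; case/andP: U'.
Qed.

(** Shortening the path to a simple one keeps only vertices of the path; if the length does not
    drop, there was no repetition. *)
Lemma dist_path_uniq u p : path (adj T) u p ->
  dist u (last u p) = size p -> uniq (u :: p).
Proof.
move=> Pp; case/shortenP: Pp => s Ps Us sub; rewrite dist_simple// => ss.
apply: (leq_size_uniq Us); last by rewrite /= ss.
by move=> x; rewrite !inE => /orP[->//|/sub ->]; rewrite orbT.
Qed.

Lemma distxx u : dist u u = 0%N.
Proof. exact: (@dist_simple _ _ u [::]). Qed.

Lemma dist_eq0 u v : dist u v = 0%N -> u = v.
Proof. by have [[|a p] [_ <- _ ->]] := simple_path_exists u v. Qed.

Lemma dist_triangle v u x : (dist u x <= dist u v + dist v x)%N.
Proof.
have [p [Pp Lp _ ->]] := simple_path_exists u v.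
have [s [Ps Ls _ ->]] := simple_path_exists v x.
rewrite -size_cat -Ls -Lp -last_cat dist_le_path// cat_path Pp Lp; exact: Ps.
Qed.

Lemma dist_le_sym u v : (dist u v <= dist v u)%N.
Proof.
have [p [Pp <- _ ->]] := simple_path_exists v u.
have es : (fun x y => adj T y x) =2 adj T by move=> x y; exact: adj_sym.
have Pr : path (adj T) (last v p) (rev (belast v p)).
  by rewrite rev_path (eq_path es).
have := dist_le_path Pr; rewrite size_rev size_belast.
case: p {Pp Pr} => [|a p] /=; first by [].
by rewrite rev_cons last_rcons.
Qed.

Lemma dist_sym u v : dist u v = dist v u.
Proof. by apply/eqP; rewrite eqn_leq !dist_le_sym. Qed.

Lemma adj_neq u v : adj T u v -> u <> v.
Proof. by move=> uv e; rewrite e adj_irr in uv. Qed.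

Lemma dist_adj u v : adj T u v -> dist u v = 1%N.
Proof.
move=> uv; have := @dist_le_path u [:: v]; rewrite /= uv => /(_ isT).
case E : (dist u v) => [|[|]]//; by move/dist_eq0: E => /(adj_neq uv).
Qed.

Lemma dist1_adj u v : dist u v = 1%N -> adj T u v.
Proof.
have [[|a [|b p]] [/= Pp <- _ ->]] := simple_path_exists u v => //.
by rewrite andbT in Pp.
Qed.

(* A tree is bipartite, so the two ends of an edge are never equidistant. *)
Lemma dist_adj_neq u v x : adj T u v ->
  dist v x = (dist u x).+1 \/ dist u x = (dist v x).+1.
Proof.
move=> uv; have [p [Pp Lp Up Ep]] := simple_path_exists v x.
have := dist_triangle v u x; have := dist_triangle u v x.
rewrite (dist_sym v u) (dist_adj uv) !add1n => vux uvx.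
have [up|up] := boolP (u \in p).
  left; suff: (dist u x < dist v x)%N by lia.
  case/splitPr: up Pp Lp Ep {Up} => p1 p2.
  rewrite cat_path last_cat /= => /and3P[_ _ P2] <- ->.
  by rewrite size_cat /= addnS ltnS (leq_trans (dist_le_path P2))// leq_addl.
right; rewrite Ep -Lp.
have := @dist_simple _ T u (v :: p); rewrite /= uv Pp => -> //.
by move: Up => /= ->; rewrite inE negb_or up !andbT; apply/eqP/adj_neq.
Qed.

(** Prefixing [u] to a geodesic from a closer neighbour to [x] gives a shortest, hence simple, path.
    Simple paths with the same ends coincide, so their first steps agree. *)
Lemma closer_neighbor_uniq u v v' x : adj T u v -> adj T u v' ->
  dist u x = (dist v x).+1 -> dist u x = (dist v' x).+1 -> v = v'.
Proof.
have key w : adj T u w -> dist u x = (dist w x).+1 ->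
    exists p, [/\ path (adj T) u (w :: p), last u (w :: p) = x & uniq (u :: w :: p)].
  move=> uw E; have [p [Pp Lp Up Ep]] := simple_path_exists w x.
  have Pw : path (adj T) u (w :: p) by rewrite /= uw.
  exists p; split => //; apply: dist_path_uniq => //=; rewrite Lp E Ep//.
move=> uv uv' /(key _ uv)[p [P L U]] /(key _ uv')[p' [P' L' U']].
by have [] : v :: p = v' :: p' by apply: simple_path_uniq P P' U U' _; rewrite L.
Qed.

Lemma closer_neighbor u x : u <> x ->
  exists v, adj T u v /\ dist u x = (dist v x).+1.
Proof.
have [[|v p] [+ <- + ->]] := simple_path_exists u x => //=.
move=> /andP[uv P] /andP[_ U] _; exists v; split => //.
by rewrite dist_simple.
Qed.

(** A total function is used so that restricting, shifting and extending are plain index changes;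
    values beyond [m] are unconstrained. *)
Definition geodesic_upto (v : nat -> T) m :=
  forall i j, (i <= j <= m)%N -> dist (v i) (v j) = (j - i)%N.

Lemma dist_le_walk (v : nat -> T) i n :
  (forall k, (k < n)%N -> (dist (v (i + k)%N) (v (i + k).+1) <= 1)%N) ->
  (dist (v i) (v (i + n)%N) <= n)%N.
Proof.
elim: n => [|n IH] H; first by rewrite addn0 distxx.
apply: leq_trans (dist_triangle (v (i + n)%N) _ _) _.
rewrite -[leqRHS]addn1 leq_add//; last by rewrite addnS; exact: H.
by apply: IH => k kn; apply: H; rewrite ltnS ltnW.
Qed.

(** Cutting at [i] and [j] gives three pieces of lengths at most [i], [j - i] and [m - j]; since the
    ends are at distance [m], no piece can be shorter. *)
Lemma geodesic_uptoP (v : nat -> T) m : dist (v 0%N) (v m) = m ->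
  (forall i, (i < m)%N -> (dist (v i) (v i.+1) <= 1)%N) -> geodesic_upto v m.
Proof.
move=> vm H i j /andP[ij jm].
have h1 : (dist (v 0%N) (v i) <= i)%N.
  by have := @dist_le_walk v 0 i; rewrite !add0n; apply => k ki; apply: H; lia.
have h2 : (dist (v i) (v j) <= j - i)%N.
  have := @dist_le_walk v i (j - i); rewrite subnKC//; apply => k ki.
  by apply: H; lia.
have h3 : (dist (v j) (v m) <= m - j)%N.
  have := @dist_le_walk v j (m - j); rewrite subnKC//; apply => k ki.
  by apply: H; lia.
have := dist_triangle (v i) (v 0%N) (v m).
have := dist_triangle (v j) (v i) (v m).
by rewrite vm; lia.
Qed.

Lemma geodesic_upto_adj (v : nat -> T) m i : geodesic_upto v m -> (i < m)%N ->
  adj T (v i) (v i.+1).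
Proof. by move=> H im; apply: dist1_adj; rewrite H; lia. Qed.

Lemma geodesic_rayP r : geodesic_ray r <-> forall m, geodesic_upto r m.
Proof.
split=> H.
  by move=> m i j /andP[ij jm]; have := H i (j - i)%N; rewrite subnKC.
by move=> i n; rewrite (H (i + n)%N) ?addKn// leq_addr leqnn.
Qed.

Lemma segment_exists u x : exists v : nat -> T,
  [/\ v 0%N = u, v (dist u x) = x & geodesic_upto v (dist u x)].
Proof.
move: {2}(dist u x) (erefl (dist u x)) => n.
elim: n u => [|n IH] u E.
  exists (fun=> u); rewrite E; split=> //; first exact: dist_eq0.
  by move=> i j; rewrite distxx; lia.
have ux : u <> x by move=> e; move: E; rewrite e distxx.
have [w [uw Ew]] := closer_neighbor ux.
have {}Ew : dist w x = n by lia.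
have [v [v0 vn gv]] := IH w Ew; rewrite Ew in vn gv.
exists (fun i => if i is k.+1 then v k else u); rewrite E; split => //.
apply: geodesic_uptoP; first by rewrite vn.
case=> [|i] ik /=; first by rewrite v0 dist_adj.
by rewrite gv; lia.
Qed.

End TreeDistance.

(** * Busemann functions of ends and the index of a vertex *)

Section Busemann.
Context {q : nat} {T : homogeneous_tree q}.
Implicit Types (u v x y : T) (w : tree_end T).

(** By the triangle inequality [dist u (r n) - n] is nonincreasing and bounded below, hence
    eventually constant. *)
Lemma busemann_exists (r : nat -> T) u : geodesic_ray r -> exists k : int,
  exists N, forall n, (N <= n)%N -> n%:Z - (dist u (r n))%:Z = k.
Proof.
move=> gr.
(* Adding [dist u (r 0)] keeps the truncated subtraction exact, so that the limit is the least value
   of a sequence of naturals. *)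
pose g n := (dist u (r n) + dist u (r 0%N) - n)%N.
have gE n : (g n + n = dist u (r n) + dist u (r 0%N))%N.
  rewrite /g subnK// addnC; have := gr 0%N n; rewrite add0n => {1}<-.
  by rewrite (dist_sym u (r 0%N)); exact: dist_triangle.
have gS n : (g n.+1 <= g n)%N.
  have := gE n; have := gE n.+1; have := dist_triangle (r n) u (r n.+1).
  by have := gr n 1%N; rewrite addn1 => ->; lia.
have gle m n : (m <= n)%N -> (g n <= g m)%N.
  move=> /subnKC <-; elim: (n - m)%N => [|k IH]; first by rewrite addn0.
  by rewrite addnS (leq_trans (gS _)).
have ex : exists k, `[< exists n, g n = k >] by exists (g 0%N); apply/asboolP; exists 0%N.
case: (ex_minnP ex) => k /asboolP[N gN] kmin.
exists ((dist u (r 0%N))%:Z - k%:Z), N => n Nn.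
have := gle _ _ Nn; rewrite gN => gk.
have := kmin (g n); have -> : `[< exists n0, g n0 = g n >] by apply/asboolP; exists n.
by move=> /(_ isT) kg; have := gE n; lia.
Qed.

Definition end_ray w : nat -> T := sval (cid2 (set_mem (valP w))).

Lemma end_ray_geodesic w : geodesic_ray (end_ray w).
Proof. by rewrite /end_ray; case: cid2. Qed.

Lemma rays_ofE w : rays_of w =
  [set r' | geodesic_ray r' /\ eventually_coincide (end_ray w) r'].
Proof. by rewrite /end_ray /rays_of; case: cid2. Qed.

(** The Busemann function of [w], increasing towards the end and zero at the origin of the chosen
    ray [end_ray w]; another ray would change it by a constant. *)
Definition busemann w u : int :=
  sval (cid (busemann_exists u (end_ray_geodesic w))).

Lemma busemannP w u : exists N, forall n, (N <= n)%N ->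
  n%:Z - (dist u (end_ray w n))%:Z = busemann w u.
Proof. by rewrite /busemann; case: cid. Qed.

(** For adjacent vertices: the step from [u] to [v] goes towards [w]. *)
Definition up w u v := busemann w v = busemann w u + 1.

Lemma busemann_adj w u v : adj T u v -> up w u v \/ up w v u.
Proof.
move=> uv; have [N HN] := busemannP w u; have [M HM] := busemannP w v.
have := HN (maxn N M); have := HM (maxn N M).
rewrite leq_maxl leq_maxr /up => /(_ isT) <- /(_ isT) <-.
have [E|E] := dist_adj_neq (end_ray w (maxn N M)) uv; rewrite E.
- by right; lia.
- by left; lia.
Qed.

Lemma upN w u v : adj T u v -> up w v u <-> ~ up w u v.
Proof. by move=> /(busemann_adj w); rewrite /up; lia. Qed.

(** A step up is a step closer to all sufficiently far points of the ray, and only one neighbour is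
    closer to a given point. *)
Lemma up_uniq w u v v' : adj T u v -> adj T u v' ->
  up w u v -> up w u v' -> v = v'.
Proof.
move=> uv uv'; have [N HN] := busemannP w u; have [M HM] := busemannP w v.
have [K HK] := busemannP w v'; pose n := (N + M + K)%N.
rewrite /up -(HN n) -?(HM n) -?(HK n); try lia.
by move=> h h'; apply: (@closer_neighbor_uniq _ _ _ _ _ (end_ray w n) uv uv'); lia.
Qed.

Lemma up_ray w r i : rays_of w r -> up w (r i) (r i.+1).
Proof.
rewrite rays_ofE => -[gr [a [b ab]]].
have key j : busemann w (r j) = a%:Z - b%:Z + j%:Z.
  have [N HN] := busemannP w (r j); pose n := (N + j)%N.
  rewrite -(HN (a + n)%N); last by lia.
  rewrite ab; have := gr j (b + n - j)%N; rewrite subnKC; last by lia.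
  by move=> ->; lia.
by rewrite /up !key; lia.
Qed.

(** Follow the segment from [u] to [end_ray w N], then the ray. Once the Busemann difference has
    stabilized, the distance from [u] grows by one at each step of the ray, so the concatenation is
    geodesic. *)
Lemma end_ray_from w u : exists r, rays_of w r /\ r 0%N = u.
Proof.
have [N HN] := busemannP w u; set D := dist u (end_ray w N).
have [v [v0 vD gv]] := segment_exists u (end_ray w N); rewrite -/D in vD gv.
pose r m := if (m <= D)%N then v m else end_ray w (N + (m - D))%N.
exists r; split; last by rewrite /r leq0n.
rewrite rays_ofE; split; last first.
  exists N, D => n; rewrite /r addKn; case: ifP => // h.
  have -> : n = 0%N by lia.
  by rewrite !addn0 vD.
apply/geodesic_rayP => m; apply: geodesic_uptoP.
  rewrite {1}/r leq0n v0 /r; case: ifP => mD; first by rewrite -v0 gv; lia.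
  have := HN N (leqnn _); have := HN (N + (m - D))%N; rewrite -/D.
  by move=> /(_ ltac:(lia)); lia.
move=> i im; rewrite /r; have := end_ray_geodesic w.
case: ltngtP => iD.
- by rewrite gv; lia.
- move=> /(_ (N + (i - D))%N 1%N).
  by have -> : (N + (i - D) + 1 = N + (i.+1 - D))%N by [lia]; move=> ->.
- by rewrite iD vD subSnn => /(_ N 1%N) ->.
Qed.

(** This replaces the index, a default-valued choice depending on a ray, by a difference of values
    of one function, so that later index computations are integer arithmetic. *)
Lemma vertex_indexE v u w : vertex_index v u w = busemann w v - busemann w u.
Proof.
have key r : rays_of w r -> \forall n \near \oo,
    (dist u (r n))%:Z - (dist v (r n))%:Z = busemann w v - busemann w u.
  rewrite rays_ofE => -[gr [a [b ab]]].
  have [N HN] := busemannP w u; have [M HM] := busemannP w v.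
  exists (N + M + b)%N => // n /= nn.
  have := ab (n - b)%N; have -> : (b + (n - b) = n)%N by lia.
  move=> <-; rewrite -(HN (a + (n - b))%N) -?(HM (a + (n - b))%N); lia.
rewrite /vertex_index; apply: xget_unique.
  by have [r [wr ru]] := end_ray_from w u; exists r; split => //; exact: key.
move=> k [r [wr ru H]].
have [n [<- <-//]] : exists n, (dist u (r n))%:Z - (dist v (r n))%:Z = k /\
    (dist u (r n))%:Z - (dist v (r n))%:Z = busemann w v - busemann w u.
  by apply: (@filter_ex _ \oo); apply: filterI => //; exact: key.
Qed.

End Busemann.

(** * Edges: chains, connecting geodesics, shadows and the index of an edge *)

Lemma set2_eq_set2 (X : Type) (a b c d : X) : [set a; b] = [set c; d] ->
  (a = c /\ b = d) \/ (a = d /\ b = c).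
Proof.
move=> E.
have ha : a = c \/ a = d by change ([set c; d] a); rewrite -E; left.
have hb : b = c \/ b = d by change ([set c; d] b); rewrite -E; right.
have hc : c = a \/ c = b by change ([set a; b] c); rewrite E; left.
have hd : d = a \/ d = b by change ([set a; b] d); rewrite E; right.
by intuition congruence.
Qed.

Section Edges.
Context {q : nat} {T : homogeneous_tree q}.
Implicit Types (u x y : T) (v : nat -> T) (w : tree_end T) (e : edge T).

Lemma edge_endpoints e : exists u x, adj T u x /\ endpoints e = [set u; x].
Proof. exact: (set_mem (valP e)). Qed.

Lemma endpoints_inj : injective (@endpoints q T).
Proof. exact: val_inj. Qed.

Lemma edge_of_adj u x : adj T u x -> exists e, endpoints e = [set u; x].
Proof.
move=> ux.
have H : [set u; x] \in @is_edge q T by apply/mem_set; exists u, x.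
by exists (exist (fun s : set T => is_true (s \in @is_edge q T)) _ H).
Qed.

Lemma dist_endpoints e u x : endpoints e u -> endpoints e x -> (dist u x <= 1)%N.
Proof.
have [a [b [ab ->]]] := edge_endpoints e.
by move=> [|] -> [|] ->; rewrite ?distxx ?(dist_sym b a) ?(dist_adj ab).
Qed.

Lemma dist_edge_chain e p u x : path (@edge_adj q T) e p ->
  endpoints e u -> endpoints (last e p) x -> (dist u x <= (size p).+1)%N.
Proof.
elim: p e u => [|e' p IH] e u /=; first by move=> _; exact: dist_endpoints.
move=> /andP[/asboolP[y ey] P] eu ex.
have [ey1 ey2] : (endpoints e `&` endpoints e') y by rewrite ey.
apply: leq_trans (dist_triangle y _ _) _.
rewrite -add1n leq_add//; first exact: dist_endpoints eu ey1.
exact: IH ey2 ex.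
Qed.

Lemma geodesic_upto_shift v n : geodesic_upto v n.+1 ->
  geodesic_upto (fun i => v i.+1) n.
Proof. by move=> gv i j ij; rewrite gv ?subSS//; lia. Qed.

(** The consecutive edges of the geodesic form a chain of length [n]; a chain with [p] steps joins
    only vertices at distance at most [p + 1], and [v 0], [v n.+1] are at distance [n + 1]. *)
Lemma edge_dist_geodesic v n e e' : geodesic_upto v n.+1 ->
  endpoints e = [set v 0%N; v 1%N] -> endpoints e' = [set v n; v n.+1] ->
  edge_dist e e' = n.
Proof.
move=> gv ee ee'.
have min p : path (@edge_adj q T) e p -> last e p = e' -> (n <= size p)%N.
  move=> P L; rewrite -ltnS.
  have := @dist_edge_chain e p (v 0%N) (v n.+1) P.
  by rewrite L ee ee' (gv 0%N) /= ?leqnn// subn0; apply; [left|right].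
suff [p [P L S]] : exists p, [/\ path (@edge_adj q T) e p, last e p = e' & size p = n].
  apply: xget_unique; first by split => //; exists p.
  move=> m [[p' [P' L' <-]] m_min]; apply/eqP; rewrite eqn_leq min// andbT.
  by rewrite -S m_min.
elim: n v e gv ee ee' {min} => [|n IH] v e gv ee ee'.
  by exists [::]; split => //=; apply: endpoints_inj; rewrite ee ee'.
have [e1 ee1] := edge_of_adj (@geodesic_upto_adj _ _ v _ 1%N gv isT).
have [p [P L S]] := IH _ e1 (geodesic_upto_shift gv) ee1 ee'.
exists (e1 :: p); split => //=; last by rewrite S.
rewrite P andbT; apply/asboolP; exists (v 1%N); rewrite ee ee1.
apply/seteqP; split=> [x [[|] -> [|]]|x ->] //.
- by move=> h; have := gv 0%N 2%N isT; rewrite (h : v 0%N = v 2%N) distxx.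
- by split; [right|left].
Qed.

(** Let [a] be the endpoint of [e0] farther from an endpoint [x] of [e]. The geodesic starts at [a]
    and ends at whichever endpoint of [e] is farther from [a]. *)
Lemma geodesic_through_edges e0 e : exists n v,
  [/\ geodesic_upto v n.+1, endpoints e0 = [set v 0%N; v 1%N] &
      endpoints e = [set v n; v n.+1]].
Proof.
have [x [y [xy ->]]] := edge_endpoints e.
have [a [b [ab [-> abx]]]] : exists a b, adj T a b /\ (endpoints e0 = [set a; b]
    /\ dist a x = (dist b x).+1).
  have [a [b [ab ee]]] := edge_endpoints e0.
  have [h|h] := dist_adj_neq x ab; last by exists a, b.
  by exists b, a; rewrite adj_sym ab ee setUC.
have [|] := dist_adj_neq a xy; rewrite !(dist_sym _ a) abx => Ey.
  have [v [v0 vn gv]] := segment_exists b x; set n := dist b x in vn gv Ey abx.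
  exists n.+1, (fun i => if i is k.+1 then if (k <= n)%N then v k else y else a).
  rewrite leqnn ltnn v0 vn leq0n; split => //.
  apply: geodesic_uptoP; first by rewrite ltnn.
  case=> [|i] ik; first by rewrite leq0n v0 dist_adj.
  case: ltngtP => iN; [by rewrite gv; lia|by rewrite distxx|].
  by rewrite iN vn (dist_adj xy).
move: Ey => [] Ey.
have [v [v0 vn gv]] := segment_exists a y; rewrite -Ey in vn gv.
set n := dist b x in vn gv Ey abx.
pose v' i := if (i <= n)%N then v i else x.
have gv' : geodesic_upto v' n.+1.
  rewrite /v'; apply: geodesic_uptoP; first by rewrite leq0n ltnn v0.
  move=> i ik; case: ltngtP => iN; [by rewrite gv; lia|by rewrite distxx|].
  by rewrite iN vn dist_sym (dist_adj xy).
exists n, v'; split => //; last by rewrite /v' leqnn ltnn vn setUC.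
have v'0 : v' 0%N = a by rewrite /v' leq0n.
rewrite v'0; congr [set _; _].
have av' : adj T a (v' 1%N) by rewrite -v'0 (geodesic_upto_adj gv').
(* Here the segment was built from [a] to [y] without mentioning [b]; its first step is [b] because
   both are the neighbour of [a] closer to [x]. *)
apply: (closer_neighbor_uniq ab av' abx).
have -> : x = v' n.+1 by rewrite /v' ltnn.
by rewrite -{1}v'0 !gv'//; lia.
Qed.

Lemma near_endpoint_up e w u x : endpoints e = [set u; x] -> adj T u x ->
  up w u x -> near_endpoint e w = x.
Proof.
move=> ee ux upx; apply: xget_unique.
  rewrite ee; split; first by right.
  by move=> y [|] -> // _; rewrite vertex_indexE upx; lia.
rewrite ee => y [[|] -> //] /(_ x); move/(_ (or_intror erefl)).
by move=> /(_ (nesym (adj_neq ux))); rewrite vertex_indexE upx; lia.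
Qed.

(* Only one neighbour of a vertex is closer to the end, so a geodesic that has
   made a step away from the end cannot approach it again. *)
Lemma up_geodesic w v n i j : geodesic_upto v n.+1 -> (i <= j <= n)%N ->
  up w (v j) (v j.+1) -> up w (v i) (v i.+1).
Proof.
move=> gv /andP[/subnKC <-]; elim: (j - i)%N => [|k IH]; first by rewrite addn0.
rewrite addnS => ik Hu; apply: IH; first by lia.
set m := (i + k)%N in ik Hu *.
have av : adj T (v m) (v m.+1) by apply: (geodesic_upto_adj gv); lia.
apply: contrapT => /(upN w av) Hd.
have a1 : adj T (v m.+1) (v m) by rewrite adj_sym (geodesic_upto_adj gv)//; lia.
have a2 : adj T (v m.+1) (v m.+2) by apply: (geodesic_upto_adj gv); lia.
have E := up_uniq a1 a2 Hd Hu.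
by have := gv m m.+2; rewrite E distxx; lia.
Qed.

(** For [n > 0] the distances from [e0] force a ray through [e] to cross it from [v n] to [v n.+1];
    for [n = 0] both orientations occur and the shadow is the whole space. *)
Lemma shadow_geodesic v n e0 e : geodesic_upto v n.+1 -> (0 < n)%N ->
  endpoints e0 = [set v 0%N; v 1%N] -> endpoints e = [set v n; v n.+1] ->
  shadow e0 e = [set w | up w (v n) (v n.+1)].
Proof.
move=> gv n0 ee0 ee; apply/seteqP; split=> w /=.
  move=> [s [_ s0 [m sm] [r wr rs]]].
  have gr : geodesic_ray r by move: wr; rewrite rays_ofE => -[].
  have d0 i : dist (r 0%N) (r i) = i by have := gr 0%N i; rewrite add0n.
  have d1 i : dist (r 1%N) (r i.+1) = i by have := gr 1%N i; rewrite add1n.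
  have upm := up_ray m wr.
  have := rs m; rewrite sm ee => Em.
  have [[-> ->]//|[Ea Eb]] := set2_eq_set2 Em.
  have ga := gv 0%N n; have gb := gv 1%N n; have gc := gv 0%N n.+1.
  move: ga gb gc; rewrite Ea Eb.
  have := rs 0%N; rewrite s0 ee0 => E0.
  by have [[-> ->]|[-> ->]] := set2_eq_set2 E0; rewrite !d0 ?d1; lia.
move=> Hu; have [r [wr r0]] := end_ray_from w (v 0%N).
have gr : geodesic_ray r by move: wr; rewrite rays_ofE => -[].
have ra i : adj T (r i) (r i.+1).
  by apply: dist1_adj; rewrite -(addn1 i); exact: gr.
(* The ray and the geodesic leave each common vertex by its unique step towards [w]. *)
have rv i : (i <= n.+1)%N -> r i = v i.
  elim: i => [//|i IH] ik; have {}IH := IH (ltnW ik).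
  apply: (@up_uniq _ _ w (r i)); [exact: ra| |exact: up_ray|].
    by rewrite IH; exact: (geodesic_upto_adj gv).
  by rewrite IH; apply: (up_geodesic gv _ Hu); lia.
have [s Hs] := choice (fun i => edge_of_adj (ra i)).
exists s; split.
- move=> i m; apply: (@edge_dist_geodesic (fun k => r (i + k)%N)).
  + by move=> a b /andP[ab bm]; rewrite -(subnKC ab) addnA gr; lia.
  + by rewrite Hs addn0 addn1.
  + by rewrite Hs addnS.
- by apply: endpoints_inj; rewrite Hs ee0 !rv.
- by exists n; apply: endpoints_inj; rewrite Hs ee !rv.
- by exists r.
Qed.

(** The extreme cases are separate because a near endpoint switches there: that of [e0] is [v 0]
    instead of [v 1] for [k = 0], that of [e] is [v n.+1] instead of [v n] for [k = n.+1]. *)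
Definition turn_index (n k : nat) : int :=
  if k == 0%N then - n%:Z else if (k <= n)%N then k%:Z *+ 2 - 1 - n%:Z else n%:Z.

(* The ends whose rays leave the geodesic [v 0, ..., v n.+1] at [v k]. *)
Definition turn v n k : set (tree_end T) :=
  [set w | forall i, (i <= n)%N -> up w (v i) (v i.+1) <-> (i < k)%N].

Lemma busemann_turn v n k w i : geodesic_upto v n.+1 -> turn v n k w ->
  (i <= n.+1)%N -> busemann w (v i) =
    busemann w (v 0%N) + (if (i <= k)%N then i%:Z else k%:Z *+ 2 - i%:Z).
Proof.
move=> gv tw; elim: i => [|i IH] ik; first by rewrite leq0n; lia.
have av := geodesic_upto_adj gv ik; have := tw i ik; have := upN w av.
have := IH (ltnW ik); rewrite /up.
by case: (leqP i k) => h1; case: (leqP i.+1 k) => h2; lia.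
Qed.

Lemma edge_index_turn v n e0 e k w : geodesic_upto v n.+1 ->
  endpoints e0 = [set v 0%N; v 1%N] -> endpoints e = [set v n; v n.+1] ->
  (k <= n.+1)%N -> turn v n k w -> edge_index e e0 w = turn_index n k.
Proof.
move=> gv ee0 ee kn tw.
have near e' i : (i <= n)%N -> endpoints e' = [set v i; v i.+1] ->
    near_endpoint e' w = if (i < k)%N then v i.+1 else v i.
  move=> i_n ee'; have av := geodesic_upto_adj gv i_n.
  case: ifPn => ik; first by apply: near_endpoint_up ee' av _; apply/(tw i i_n).
  apply: (@near_endpoint_up _ _ (v i.+1)); rewrite 1?setUC// 1?adj_sym//.
  by apply/(upN w av)/(tw i i_n)/negP.
rewrite /edge_index vertex_indexE (near e0 0%N)// (near e n)// /turn_index.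
have b1 := busemann_turn (i := 1) gv tw isT.
have bn := busemann_turn (i := n) gv tw (leqnSn n).
have bN := busemann_turn (i := n.+1) gv tw (leqnn _).
move: b1 bn bN; case: posnP => [->|k0]; first by rewrite ltn0; do ?case: ifP; lia.
by case: (ltnP n k) => nk; do ?case: ifP; lia.
Qed.

(** Take the first step that does not go up, or [n.+1] if there is none; by [up_geodesic] no later
    step goes up. *)
Lemma turn_exists v n w : geodesic_upto v n.+1 -> exists2 k, (k <= n.+1)%N & turn v n k w.
Proof.
move=> gv; have ex : exists k, (k == n.+1) || ~~ `[< up w (v k) (v k.+1) >].
  by exists n.+1; rewrite eqxx.
case: (ex_minnP ex) => k Hk kmin.
have kn : (k <= n.+1)%N by apply: kmin; rewrite eqxx.
exists k => // i i_n; split=> [Hu|ik].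
  rewrite ltnNge; apply/negP => ki; move: Hk; rewrite ltn_eqF ?ltnS ?(leq_trans ki)//=.
  by move=> /asboolP; apply; apply: (up_geodesic gv _ Hu); rewrite ki.
apply: contrapT => /asboolPn Hu; have := kmin i; rewrite Hu orbT => /(_ isT); lia.
Qed.

(** The bounds matter: all [k > n] define the same set of ends. *)
Lemma turn_uniq v n w k k' : (k <= n.+1)%N -> (k' <= n.+1)%N ->
  turn v n k w -> turn v n k' w -> k = k'.
Proof.
move=> kn kn' H H'; case: (ltngtP k k') => // h.
  have k_n : (k <= n)%N by lia.
  by have := (H k k_n).1 ((H' k k_n).2 h); rewrite ltnn.
have k_n : (k' <= n)%N by lia.
by have := (H' k' k_n).1 ((H k' k_n).2 h); rewrite ltnn.
Qed.
End Edges.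

(** * Cones of ends and measurability of the turning sets *)

Section Cones.
Context {q : nat} {T : homogeneous_tree q}.
Implicit Types (u x y : T) (v : nat -> T) (w : tree_end T) (e : edge T).

(** For adjacent vertices, the ends beyond [x] as seen from [u]; unlike a shadow, it refers to no
    starting edge. *)
Definition cone u x : set (end_borel T) := [set w | up w u x].

Lemma geodesic_upto2 y u x : adj T y u -> adj T u x -> y <> x ->
  geodesic_upto (nth x [:: y; u]) 2.
Proof.
move=> yu ux yx; apply: geodesic_uptoP.
  have := @dist_simple _ T y [:: u; x]; rewrite /= yu ux !inE => -> //.
  by move/eqP/negPf: yx => ->; rewrite orbF andbT !(introN eqP (adj_neq _)).
by case=> [|[|//]] _ /=; rewrite dist_adj.
Qed.

Lemma measurable_shadow e e' : measurable (shadow e e' : set (end_borel T)).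
Proof. by apply: sub_sigma_algebra => w ww; exists e, e'; split. Qed.

(** As degrees are at least 2, some neighbour [y] of [u] differs from [x]; the cone is the shadow of
    the edge [u x] from the edge [y u]. *)
Lemma measurable_cone u x : adj T u x -> measurable (cone u x).
Proof.
move=> ux; have [y [uy yx]] := other_neighbor x u.
rewrite adj_sym in uy.
have [e ee] := edge_of_adj uy; have [e' ee'] := edge_of_adj ux.
rewrite -[cone _ _](shadow_geodesic (geodesic_upto2 uy ux yx) _ ee ee')//.
exact: measurable_shadow.
Qed.

Lemma turn_first v n : geodesic_upto v n.+1 ->
  turn v n 0 = ~` cone (v 0%N) (v 1%N).
Proof.
move=> gv; apply/seteqP; split=> w; first by move=> /(_ 0%N isT)[+ _] => /[apply].
by move=> nu0 i i_n; split => // ui; case: nu0; exact: (up_geodesic gv _ ui).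
Qed.

Lemma turn_last v n : geodesic_upto v n.+1 -> turn v n n.+1 = cone (v n) (v n.+1).
Proof.
move=> gv; apply/seteqP; split=> w; first by move=> /(_ n (leqnn _))[_]; apply.
move=> un i i_n; split => // _; apply: (up_geodesic gv _ un); by rewrite i_n leqnn.
Qed.

(** The cones along a geodesic decrease, so two consecutive ones decide every step. *)
Lemma turn_middle v n k : geodesic_upto v n.+1 -> (k < n)%N ->
  turn v n k.+1 = cone (v k) (v k.+1) `\` cone (v k.+1) (v k.+2).
Proof.
move=> gv kn; apply/seteqP; split=> w.
  move=> tw; split; first by apply/(tw k (ltnW kn)).
  by move=> /(tw k.+1 kn); rewrite ltnn.
move=> [uk nuk] i i_n; split => [ui|ik].
  rewrite ltnNge; apply/negP => ki; apply: nuk; apply: (up_geodesic gv _ ui).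
  by rewrite ki.
by apply: (up_geodesic gv _ uk); lia.
Qed.

Lemma measurable_turn v n k : geodesic_upto v n.+1 -> (k <= n.+1)%N ->
  measurable (turn v n k : set (end_borel T)).
Proof.
move=> gv; have mc i : (i <= n)%N -> measurable (cone (v i) (v i.+1)).
  by move=> i_n; apply: measurable_cone; exact: (geodesic_upto_adj gv).
case: k => [_|k]; first by rewrite turn_first//; apply: measurableC; exact: mc.
rewrite ltnS leq_eqVlt => /predU1P[->|kn]; first by rewrite turn_last//; exact: mc.
by rewrite turn_middle//; apply: measurableD; apply: mc; lia.
Qed.

(** The ray from [x] to an end of the cone leaves [x] by a neighbour other than [u]. *)
Lemma cone_bigcup u x : adj T u x ->
  cone u x = \bigcup_(y in [set y | adj T x y] `\ u) cone x y.
Proof.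
move=> ux; apply/seteqP; split=> w.
  move=> uw; have [r [wr rx]] := end_ray_from w x.
  have ur := up_ray 0%N wr; rewrite rx in ur.
  have gr : geodesic_ray r by move: wr; rewrite rays_ofE => -[].
  exists (r 1%N) => //; split; last first.
    by move=> /= ru; rewrite ru in ur; move/(upN w ux): ur; apply.
  by rewrite /= -rx; apply: dist1_adj; exact: (gr 0%N 1%N).
move=> [y [/= xy yu] cy]; apply: contrapT => /(upN w ux) xu; apply: yu.
by apply: (up_uniq xy _ cy xu); rewrite adj_sym.
Qed.

End Cones.

(** * The law of the turning vertex under the end measure *)

Definition turn_mass (R : realType) (q n k : nat) : R :=
  if k == 0%N then 2^-1
  else if (k <= n)%N then (2 * q%:R ^+ k.-1)^-1 - (2 * q%:R ^+ k)^-1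
  else (2 * q%:R ^+ n)^-1.

Section EndMeasure.
Context {R : realType} {q : nat} {T : homogeneous_tree q}.
Variables (e0 : edge T) (nu : probability (end_borel T) R).
Hypothesis Hnu : is_end_measure e0 nu.

Lemma q_gt0 : 0 < q%:R :> R.
Proof. by rewrite ltr0n (tree_degree_gt0 T). Qed.

(** The hypothesis on [nu] speaks only of positive distances, so the mass 1/2 is obtained by
    splitting the cone into [q] cones of mass [1/(2q)]. *)
Lemma measure_cone_base (u x : T) : adj T u x -> endpoints e0 = [set u; x] ->
  nu (cone u x) = (2^-1)%:E.
Proof.
move=> ux ee0; rewrite cone_bigcup//.
have Af : finite_set [set y | adj T x y].
  by apply/finite_setP; exists q.+1; exact: tree_homogeneous.
have Df : finite_set ([set y | adj T x y] `\ u) by exact: finite_setD.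
rewrite measure_fin_bigcup//; last 2 first.
- move=> y y' [/= xy _] [/= xy' _] [w [wy wy']]; exact: up_uniq wy wy'.
- by move=> y [/= xy _]; exact: measurable_cone.
have D : #|` fset_set ([set y | adj T x y] `\ u)| = q.
  have := card_fset_set (tree_homogeneous x); rewrite (cardfsD1 u).
  rewrite in_fset_set// mem_set/=; last by rewrite adj_sym.
  rewrite add1n => -[E]; rewrite -[RHS]E; congr (#|` _|).
  apply/fsetP => y; rewrite !inE !in_fset_set//.
  apply/idP/andP => [/set_mem[a b]|[/eqP b /set_mem a]].
    by split; [exact/eqP|exact/mem_set].
  by apply/mem_set; split.
rewrite (eq_fsbigr (fun=> ((2 * q%:R)^-1 : R)%:E)); last first.
  move=> y /set_mem[/= xy yu].
  have [e ee] := edge_of_adj xy.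
  have gv := geodesic_upto2 ux xy (nesym yu).
  rewrite -[cone _ _](shadow_geodesic gv _ ee0 ee)//.
  by rewrite (@Hnu e 1%N)// ?expr1//; exact: (edge_dist_geodesic gv).
rewrite fsbig_finite//= sumEFin big_const_seq count_predT D iter_addr_0.
rewrite -[X in X%:E]mulr_natr invfM -mulrA mulVf ?mulr1//.
by rewrite gt_eqF// q_gt0.
Qed.

Lemma measure_cone v n : geodesic_upto v n.+1 -> endpoints e0 = [set v 0%N; v 1%N] ->
  nu (cone (v n) (v n.+1)) = ((2 * q%:R ^+ n)^-1)%:E.
Proof.
move=> gv ee0; have av := geodesic_upto_adj gv (ltnSn n).
case: n gv av => [gv av|n gv av]; first by rewrite measure_cone_base// expr0 mulr1.
have [e ee] := edge_of_adj av.
rewrite -[cone _ _](shadow_geodesic gv _ ee0 ee)//.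
by apply: Hnu => //; exact: (edge_dist_geodesic gv).
Qed.

Lemma measure_turn v n k : geodesic_upto v n.+1 ->
  endpoints e0 = [set v 0%N; v 1%N] -> (k <= n.+1)%N ->
  nu (turn v n k) = (turn_mass R q n k)%:E.
Proof.
move=> gv ee0.
have gvk i : (i <= n)%N -> geodesic_upto v i.+1.
  by move=> i_n a b ab; apply: gv; lia.
have mc i : (i <= n)%N -> measurable (cone (v i) (v i.+1)).
  by move=> i_n; apply: measurable_cone; exact: (geodesic_upto_adj gv).
case: k => [_|k].
  rewrite turn_first// probability_setC ?(measure_cone (gvk _ _))//; last exact: mc.
  by rewrite expr0 mulr1 /turn_mass/= -EFinB; congr EFin; lra.
rewrite /turn_mass/= ltnS leq_eqVlt => /predU1P[->|kn].
  by rewrite turn_last// ltnn (measure_cone gv).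
rewrite turn_middle// kn measureD; [|exact: mc (ltnW kn)|exact: mc|].
  rewrite setIidr; last by move=> w; apply: (up_geodesic gv); rewrite leqnSn.
  rewrite EFinB; congr (_ - _)%E.
    exact: (measure_cone (gvk _ (ltnW kn))).
  exact: (measure_cone (gvk _ kn)).
by rewrite ltey_eq fin_num_measure//; exact: mc (ltnW kn).
Qed.

(** A union over [k] is needed for [n = 0], where both turns have index 0. *)
Lemma edge_index_bigcup v n e m : geodesic_upto v n.+1 ->
  endpoints e0 = [set v 0%N; v 1%N] -> endpoints e = [set v n; v n.+1] ->
  [set w | edge_index e e0 w = m] =
    \big[setU/set0]_(k < n.+2 | turn_index n k == m) turn v n k.
Proof.
move=> gv ee0 ee; rewrite -bigcup_seq_cond; apply/seteqP; split=> w /=.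
  move=> E; have [k kn tw] := turn_exists w gv.
  exists (Ordinal (kn : k < n.+2)%N) => //=.
  by rewrite mem_index_enum -E (edge_index_turn gv ee0 ee kn tw) eqxx.
move=> [k /= /andP[_ /eqP <-] tw]; apply: (edge_index_turn gv ee0 ee) tw.
by rewrite -ltnS.
Qed.

Lemma measurable_edge_index e m :
  measurable ([set w | edge_index e e0 w = m] : set (end_borel T)).
Proof.
have [n [v [gv ee0 ee]]] := geodesic_through_edges e0 e.
rewrite (edge_index_bigcup m gv ee0 ee); apply: bigsetU_measurable => k _.
by apply: measurable_turn => //; rewrite -ltnS.
Qed.

Lemma measure_edge_index v n e m : geodesic_upto v n.+1 ->
  endpoints e0 = [set v 0%N; v 1%N] -> endpoints e = [set v n; v n.+1] ->
  nu [set w | edge_index e e0 w = m] =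
    (\sum_(k < n.+2 | turn_index n k == m) turn_mass R q n k)%:E.
Proof.
move=> gv ee0 ee; rewrite (edge_index_bigcup m gv ee0 ee).
rewrite measure_bigsetU_ord_cond; last 2 first.
- by move=> k _; apply: measurable_turn => //; rewrite -ltnS.
- move=> k k' _ _ [w [tw tw']]; apply/val_inj.
  by apply: turn_uniq tw tw'; rewrite -ltnS.
rewrite -sumEFin; apply: eq_bigr => k _; apply: measure_turn => //.
by rewrite -ltnS.
Qed.
End EndMeasure.

(** * Means of coefficients under the law of the index *)

Section TurnAverage.
Context {R : realType} (q : nat).
Hypothesis q0 : (0 < q)%N.
Implicit Types c : int -> R.

Definition turn_average n c : R :=
  \sum_(k < n.+2) c (turn_index n k) * turn_mass R q n k.

(** The turns [k = j + 1] with [1 <= k <= n], scaled by [2 q^n] and stripped of the common factor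
    [q - 1]. *)
Definition inner_sum n c : R :=
  \sum_(j < n) q%:R ^+ (n - j.+1) * c (j%:Z *+ 2 + 1 - n%:Z).

Let Q0 : q%:R != 0 :> R.
Proof. by rewrite pnatr_eq0 -lt0n. Qed.

Lemma turn_averageE n c : 2 * q%:R ^+ n * turn_average n c =
  q%:R ^+ n * c (- n%:Z) + c n%:Z + (q%:R - 1) * inner_sum n c.
Proof.
have Qn k : q%:R ^+ k != 0 :> R by rewrite expf_neq0.
have Q2n k : 2 * q%:R ^+ k != 0 :> R by rewrite mulf_neq0.
have -> : turn_average n c = c (- n%:Z) * 2^-1 + (\sum_(j < n)
    c (j%:Z *+ 2 + 1 - n%:Z) * ((q%:R - 1) * (2 * q%:R ^+ j.+1)^-1))
    + c n%:Z * (2 * q%:R ^+ n)^-1.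
  rewrite /turn_average big_ord_recl big_ord_recr /= addrA.
  rewrite /turn_index /turn_mass /= /bump /= add1n ltnn; congr (_ + _ + _).
  apply: eq_bigr => j _; rewrite /= add1n ltn_ord; congr (c _ * _); first by lia.
  rewrite mulrBl mul1r; congr (_ - _).
  by rewrite [in RHS]exprS [in RHS]mulrCA [in RHS]invfM mulrA mulfV// mul1r.
rewrite !mulrDr -addrA [X in _ + X = _]addrC addrA; congr (_ + _ + _).
- by rewrite mulrACA [X in X * _]mulrC; lra.
- by rewrite mulrCA mulfV// mulr1.
- rewrite !mulr_sumr; apply: eq_bigr => j _.
  have -> : q%:R ^+ n = q%:R ^+ (n - j.+1) * q%:R ^+ j.+1 :> R.
    by rewrite -exprD subnK.
  have yx := mulfV (Q2n j.+1); set x := (_ * _)^-1 in yx *.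
  set y := q%:R ^+ j.+1 in yx *; set a := q%:R ^+ _; set b := c _.
  transitivity ((q%:R - 1) * (a * b) * (2 * y * x)); first by lra.
  by rewrite yx mulr1.
Qed.

Lemma inner_sum0 c : inner_sum 0 c = 0.
Proof. by rewrite /inner_sum big_ord0. Qed.

Lemma inner_sum1 c : inner_sum 1 c = c 0.
Proof. by rewrite /inner_sum big_ord1 subnn mul1r. Qed.

(** The inner indices run in steps of 2 from [1 - n] to [n - 1], so passing from [n] to [n + 2] only
    adds one term at each end and shifts the powers of [q]. *)
Lemma inner_sumSS n c : inner_sum n.+2 c =
  q%:R ^+ n.+1 * c (- n.+1%:Z) + c n.+1%:Z + q%:R * inner_sum n c.
Proof.
rewrite /inner_sum big_ord_recl big_ord_recr /= subnn mul1r -[RHS]addrA; congr (_ + _).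
  by rewrite subSS subn0; congr (_ * c _); lia.
rewrite [RHS]addrC mulr_sumr; congr (_ + _); last by congr c; rewrite /bump /=; lia.
apply: eq_bigr => j _; rewrite mulrA -exprS /bump /= add1n.
congr (_ ^+ _ * c _); last by lia.
by have := ltn_ord j; lia.
Qed.

Lemma turn_average0 c : turn_average 0 c = c 0.
Proof.
have := turn_averageE 0 c; rewrite inner_sum0 expr0 oppr0; lra.
Qed.

(** The hypotheses are the cases [n = 1] and [n = 2] and the step from [n] to [n + 2] after
    elimination of the inner sum. The case [n = 2] is separate because the mean at 0 need not be
    [K]. *)
Lemma turn_average_rec c K :
  q%:R * c (-1) + c 1 + (q%:R - 1) * c 0 = 2 * q%:R * K ->
  q%:R ^+ 2 * c (-2) + c 2 + (q%:R - 1) * (q%:R * c (-1) + c 1) = 2 * q%:R ^+ 2 * K ->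
  (forall n, (0 < n)%N -> q%:R ^+ n.+2 * c (- n.+2%:Z) + c n.+2%:Z
     + (q%:R - 1) * (q%:R ^+ n.+1 * c (- n.+1%:Z) + c n.+1%:Z) =
     q%:R * (q%:R ^+ n * c (- n%:Z) + c n%:Z)
     + 2 * q%:R ^+ n.+1 * (q%:R - 1) * K) ->
  forall n, (0 < n)%N -> turn_average n c = K.
Proof.
move=> H1 H2 Hs n n0.
have QQ k : 2 * q%:R ^+ k != 0 :> R by rewrite mulf_neq0// expf_neq0.
apply: (mulfI (QQ n)); rewrite turn_averageE.
elim/ltn_ind: n n0 => -[//|[|[|n]]] IH _.
- by rewrite inner_sum1 expr1.
- by rewrite inner_sumSS inner_sum0 mulr0 addr0.
- rewrite inner_sumSS mulrDr addrA Hs// [(_ - 1) * (_ * _)]mulrCA.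
  (* The induction hypothesis is solved for the inner sum. *)
  have /(canRL (addKr _)) -> := IH n.+1 (leqnSn _) isT.
  by rewrite (exprS _ n.+2) (exprS _ n.+1); set x := _ ^+ n.+1; lra.
Qed.

Lemma turn_mass_ge0 n k : 0 <= turn_mass R q n k.
Proof.
rewrite /turn_mass; case: posnP => // k0; case: ifP => _; last first.
  by rewrite invr_ge0 mulr_ge0// exprn_ge0.
have Qk i : 0 < q%:R ^+ i :> R by rewrite exprn_gt0// ltr0n.
rewrite subr_ge0 lef_pV2 ?posrE ?mulr_gt0// ler_pM2l// ler_weXn2l ?ler1n//.
exact: leq_pred.
Qed.

Lemma ler_turn_average n c c' : (forall m, c m <= c' m) ->
  turn_average n c <= turn_average n c'.
Proof. by move=> cc'; apply: ler_sum => k _; rewrite ler_wpM2r// turn_mass_ge0. Qed.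

Lemma turn_averageB n c c' :
  turn_average n (fun m => c m - c' m) = turn_average n c - turn_average n c'.
Proof. by rewrite /turn_average -sumrB; apply: eq_bigr => k _; rewrite mulrBl. Qed.

Lemma turn_averageZ n a c :
  turn_average n (fun m => a * c m) = a * turn_average n c.
Proof. by rewrite /turn_average mulr_sumr; apply: eq_bigr => k _; rewrite mulrA. Qed.

(* The function [m |-> q ^ m] is the Poisson kernel in terms of the index, so
   it has mean 1 as constants do; this bounds the mean of any coefficients growing
   at most like [q ^ m] at [+oo] and bounded at [-oo]. *)
Lemma turn_average_poisson n : turn_average n (fun m => 1 + q%:R ^ m) = 2.
Proof.
case: n => [|n]; first by rewrite turn_average0.
have P i : q%:R ^+ i * (1 + q%:R ^ (- i%:Z)) = q%:R ^+ i + 1 :> R.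
  by rewrite -exprnN mulrDr mulr1 mulfV// expf_neq0.
apply: turn_average_rec => // [||k _].
- have := P 1%N; rewrite expr1 /= expr0z expr1z => ->; lra.
- have := P 1%N; have := P 2%N; rewrite expr1 /= -!exprnP => -> ->; lra.
- rewrite !P -!exprnP !exprS; move: (_ ^+ k) => t; lra.
Qed.

Lemma turn_average_one_sided n : turn_average n (coef_one_sided R q) = (n == 0%N)%:R.
Proof.
case: n => [|n]; first by rewrite turn_average0.
have Q1 : 1 + q%:R != 0 :> R by rewrite nat1r pnatr_eq0.
(* Naming the quotient and keeping only [kE] avoids division in the identities given to [lra]. *)
pose k : R := (1 - q%:R) / (1 + q%:R).
have kE : k * (1 + q%:R) = 1 - q%:R by rewrite mulfVK.
have l_neg i : coef_one_sided R q (- i.+1%:Z) = 0 by [].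
have l_pos i : coef_one_sided R q i.+1%:Z = k * (1 - (- q%:R) ^+ i.+1) by [].
apply: turn_average_rec => // [||i i0].
- by rewrite (l_neg 0%N) (l_pos 0%N) /coef_one_sided/= expr1; lra.
- rewrite (l_neg 0%N) (l_neg 1%N) (l_pos 0%N) (l_pos 1%N) expr1 expr2.
  (* The case [n = 2] involves [k (1 - q^2)], which is [k (1 + q)] times [1 - q]. *)
  by have := congr1 ( *%R^~ (1 - q%:R)) kE => /=; lra.
- case: i i0 => // i _; rewrite !l_neg !l_pos !mulr0.
  by rewrite !(exprS (- _)); move: ((- _) ^+ i) => x; lra.
Qed.

Lemma turn_average_two_sided n : turn_average n (coef_two_sided R q) = (n == 0%N)%:R.
Proof.
case: n => [|n]; first by rewrite turn_average0 /coef_two_sided/= expr0z.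
have Q1 : 1 + q%:R != 0 :> R by rewrite nat1r pnatr_eq0.
have kE : (1 + q%:R)^-1 * (1 + q%:R) = 1 :> R by rewrite mulVf.
set k : R := (1 + q%:R)^-1 in kE.
have l_neg i : q%:R ^+ i * coef_two_sided R q (- i%:Z) = (- q%:R) ^+ i.
  rewrite /coef_two_sided lerNl oppr0 lez_nat leq0n -exprnN invr_sign.
  by rewrite (exprNn q%:R) mulrC.
have l_pos i : coef_two_sided R q i.+1%:Z = 2 * ((1 - (- q%:R) ^+ i.+1) * k) - 1 by [].
apply: turn_average_rec => // [||i i0].
- have := l_neg 1%N; rewrite !expr1 => ->.
  by rewrite (l_pos 0%N) /coef_two_sided/= expr1 expr0z; lra.
- have := l_neg 1%N; have := l_neg 2%N; rewrite !expr1 => -> ->.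
  rewrite (l_pos 0%N) (l_pos 1%N) expr1 expr2.
  by have := congr1 ( *%R^~ (1 - q%:R)) kE => /=; lra.
- rewrite mulr0 addr0 !l_neg; case: i i0 => // i _; rewrite !l_pos.
  by rewrite !(exprS (- _)); move: ((- _) ^+ i) => x; lra.
Qed.

End TurnAverage.

(** * Unordered sums over countable types and Tonelli exchanges *)

Section Esum.
Local Open Scope ereal_scope.
Context {R : realType}.

Lemma esumZl (I : choiceType) (D : set I) (x : R) (a : I -> \bar R) :
  (0 <= x)%R -> (forall i, 0 <= a i) ->
  \esum_(i in D) (x%:E * a i) = x%:E * \esum_(i in D) a i.
Proof.
move=> x0 a0; rewrite /esum -ereal_supZl//; last first.
  by apply/set0P; exists (\sum_(i \in set0) a i); exists set0 => //; exact: fsets_set0.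
congr ereal_sup; apply/seteqP; split=> [_ [A FA <-]|_ [_ [A FA <-] <-]].
  by exists (\sum_(i \in A) a i); [exists A|rewrite ge0_mule_fsumr].
by exists A => //; rewrite ge0_mule_fsumr.
Qed.

Lemma exchange_esum (I J : choiceType) (a : I -> J -> \bar R) :
  (forall i j, 0 <= a i j) ->
  \esum_(i in [set: I]) \esum_(j in [set: J]) a i j =
  \esum_(j in [set: J]) \esum_(i in [set: I]) a i j.
Proof.
move=> a0; rewrite !esum_esum//.
rewrite (@reindex_esum _ _ _ ([set: J] `*`` (fun=> [set: I])) _ (fun k => (k.2, k.1)))//.
split=> //; first by move=> [i j] [k l] _ _ [-> ->].
by move=> [i j] _; exists (j, i).
Qed.

(** Reduces unordered sums to series, for which measurability and monotone convergence are
    available. The enumeration [h] does not depend on [a], so one serves all points of a space. *)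
Lemma esum_countable (I : choiceType) (D : set I) : countable D ->
  exists h : nat -> option I, forall a : I -> \bar R, (forall i, 0 <= a i) ->
    \esum_(i in D) a i = \sum_(n <oo) (if h n is Some i then a i else 0).
Proof.
move=> /countable_injP[f finj].
pose h n := if pselect (exists2 i, D i & f i = n) is left H
  then Some (sval (cid2 H)) else None.
exists h => a a0; rewrite nneseries_esumT; last by move=> n; case: (h n).
rewrite [RHS](_ : _ = \esum_(n in f @` D) (if h n is Some i then a i else 0)).
  rewrite esum_image//; apply: eq_esum => i Di; rewrite /h.
  case: pselect => [H|[]]; last by exists i.
  case: cid2 => j Dj ji /=; congr a; apply: finj => //; exact: mem_set.
rewrite [RHS]esum_mkcond; apply: eq_esum => n _; rewrite /h.
case: pselect => [[i Di fi]|H]; first by rewrite mem_set//; exists i.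
by case: ifP.
Qed.

Context d (X : measurableType d) (mu : {measure set X -> \bar R}).

Lemma ge0_emeasurable_esum (I : choiceType) (D : set I) (a : I -> X -> \bar R) :
  countable D -> (forall i x, 0 <= a i x) -> (forall i, measurable_fun setT (a i)) ->
  measurable_fun setT (fun x => \esum_(i in D) a i x).
Proof.
move=> /esum_countable[h hE] a0 ma.
rewrite (_ : (fun _ => _) =
    (fun x => \sum_(n <oo | n \in predT) if h n is Some i then a i x else 0)).
  apply: ge0_emeasurable_sum => [n x _ _|n _]; first by case: (h n).
  by case: (h n) => //; exact: measurable_cst.
by apply/funext => x; rewrite hE.
Qed.

Lemma ge0_integral_esum (I : choiceType) (D : set I) (a : I -> X -> \bar R) :
  countable D -> (forall i x, 0 <= a i x) -> (forall i, measurable_fun setT (a i)) ->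
  \int[mu]_x (\esum_(i in D) a i x) = \esum_(i in D) \int[mu]_x a i x.
Proof.
move=> /esum_countable[h hE] a0 ma.
rewrite hE; last by move=> i; exact: integral_ge0.
under eq_integral do rewrite hE//.
rewrite integral_nneseries//.
- by apply: eq_eseriesr => n _; case: (h n) => //; rewrite integral0.
- by move=> n; case: (h n) => //; exact: measurable_cst.
- by move=> n x _; case: (h n).
Qed.

End Esum.

(** * Sums over all integers *)

Section BilateralSum.
Context {R : realType}.
Implicit Types a b : int -> R.

Lemma bilateral_sum_unique a s t : bilateral_sum a s -> bilateral_sum a t -> s = t.
Proof.
move=> [s1 [s2 [hs1 hs2 ->]]] [t1 [t2 [ht1 ht2 ->]]].
by congr (_ + _); [apply: cvg_unique hs1 ht1|apply: cvg_unique hs2 ht2].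
Qed.

Lemma bilateral_sumD a b s t : bilateral_sum a s -> bilateral_sum b t ->
  bilateral_sum (fun n => a n + b n) (s + t).
Proof.
move=> [s1 [s2 [hs1 hs2 ->]]] [t1 [t2 [ht1 ht2 ->]]].
exists (s1 + t1), (s2 + t2); split; last by rewrite addrACA.
- rewrite [X in X @ _](_ : _ = series (a \o Posz) \+ series (b \o Posz)).
    exact: cvgD.
  by apply/funext => n; rewrite /series/= big_split.
- rewrite [X in X @ _](_ : _ = series (a \o Negz) \+ series (b \o Negz)).
    exact: cvgD.
  by apply/funext => n; rewrite /series/= big_split.
Qed.

Lemma bilateral_sumZ k a s : bilateral_sum a s ->
  bilateral_sum (fun n => k * a n) (k * s).
Proof.
move=> [s1 [s2 [hs1 hs2 ->]]].
exists (k * s1), (k * s2); split; last by rewrite mulrDr.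
- rewrite [X in X @ _](_ : _ = (fun n => k * series (a \o Posz) n)).
    exact: cvgMr.
  by apply/funext => n; rewrite /series/= mulr_sumr.
- rewrite [X in X @ _](_ : _ = (fun n => k * series (a \o Negz) n)).
    exact: cvgMr.
  by apply/funext => n; rewrite /series/= mulr_sumr.
Qed.

Lemma bilateral_sumB a b s t : bilateral_sum a s -> bilateral_sum b t ->
  bilateral_sum (fun n => a n - b n) (s - t).
Proof.
move=> ha /(bilateral_sumZ (-1)) hb; have := bilateral_sumD ha hb.
rewrite mulN1r; congr bilateral_sum; apply/funext => n; by rewrite mulN1r.
Qed.

Lemma cvg_series_nneseries (u : nat -> R) s : (forall n, 0 <= u n) ->
  (\sum_(n <oo) (u n)%:E)%E = s%:E -> series u @ \oo --> s.
Proof.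
move=> u0 us.
have h : (fun n => \sum_(0 <= k < n) (u k)%:E)%E @ \oo --> s%:E.
  by rewrite -us; apply: is_cvg_nneseries => n _ _; rewrite lee_fin.
rewrite [X in X @ _](_ : _ = fine \o (fun n => \sum_(0 <= k < n) (u k)%:E)%E).
  exact: fine_cvg.
by apply/funext => n; rewrite /= sumEFin.
Qed.

(** The integers split into the ranges of [Posz] and [Negz]; since the terms are nonnegative and the
    total is finite, both halves are finite. *)
Lemma bilateral_sum_esum a s : (forall n, 0 <= a n) ->
  (\esum_(n in [set: int]) (a n)%:E = s%:E)%E -> bilateral_sum a s.
Proof.
move=> a0; rewrite (esumID (range Posz)); last by move=> n _; rewrite lee_fin.
rewrite !setTI (_ : ~` range Posz = range Negz); last first.
  apply/seteqP; split=> [[n|n]|_ [n _ <-] [m _ //]]; last by exists n.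
  by move=> /(_ (ex_intro2 _ _ n I erefl)).
rewrite !esum_image; [|by move=> m n _ _ []|by move=> m n _ _ []].
have E0 (g : nat -> int) n : (0 <= (a (g n))%:E)%E by rewrite lee_fin.
rewrite -!nneseries_esumT//.
have := @nneseries_ge0 R (fun n => (a (Posz n))%:E) xpredT 0 (fun n _ _ => E0 Posz n).
have := @nneseries_ge0 R (fun n => (a (Negz n))%:E) xpredT 0 (fun n _ _ => E0 Negz n).
have := @cvg_series_nneseries (a \o Posz) _ (fun n => a0 _).
have := @cvg_series_nneseries (a \o Negz) _ (fun n => a0 _) => /=.
set p := (\sum_(i <oo) (a (Posz i))%:E)%E; set m := (\sum_(i <oo) (a (Negz i))%:E)%E.
case: p => [s1||]; case: m => [s2||] // H2 H1 _ _ [<-].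
by exists s1, s2; split => //; [exact: H1|exact: H2].
Qed.

End BilateralSum.

(** * Countability of the vertices and edges *)

Section CountableTree.
Context {q : nat} {T : homogeneous_tree q}.

(** Each sphere about [v0] consists of neighbours of the previous one, and every vertex has finitely
    many neighbours. *)
Lemma countable_vertices : countable [set: T].
Proof.
have [v0 _] := @tree_nonempty _ T.
have ballc n : countable [set u : T | dist v0 u = n].
  elim: n => [|n IH].
    apply: (@sub_countable _ _ _ [set v0]) => //.
    by apply: subset_card_le => u /dist_eq0 <-.
  apply: (@sub_countable _ _ _
    (\bigcup_(u in [set u : T | dist v0 u = n]) [set y | adj T u y])); last first.
    apply: bigcup_countable => // u _; apply: finite_set_countable.
    by apply/finite_setP; exists q.+1; exact: tree_homogeneous.
  apply: subset_card_le => y /= yn.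
  have [v [v0E vn gv]] := segment_exists v0 y; rewrite yn in vn gv.
  exists (v n); first by rewrite /= -v0E gv; lia.
  by rewrite /= -vn; exact: (geodesic_upto_adj gv).
apply: (@sub_countable _ _ _ (\bigcup_n [set u : T | dist v0 u = n])).
  by apply: subset_card_le => u _; exists (dist v0 u).
exact: bigcup_countable.
Qed.

Lemma countable_edges : countable [set: edge T].
Proof.
have [u Hu] := choice (@edge_endpoints _ T); have [x Hx] := choice Hu.
have inj : injective (fun e => (u e, x e)).
  move=> e e' [eu ex]; apply: endpoints_inj.
  by have [_ ->] := Hx e; have [_ ->] := Hx e'; rewrite eu ex.
have /countable_injP[g gi] := countable_vertices.
have {}gi : injective g by move=> a b; apply: gi; exact: mem_set.
apply/countable_injP; exists (fun e => choice.pickle (g (u e), g (x e))).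
move=> e e' _ _ /(pcan_inj choice.pickleK)[] /gi eu /gi ex.
by apply: inj => /=; rewrite eu ex.
Qed.

Lemma edge_dist_eq0 (e0 e : edge T) : edge_dist e0 e = 0%N <-> e = e0.
Proof.
have [n [v [gv ee0 ee]]] := geodesic_through_edges e0 e.
rewrite (edge_dist_geodesic gv ee0 ee); split=> [n0|e_e0].
  by apply: endpoints_inj; rewrite ee0 ee n0.
have [[E _]|[_ E]] := set2_eq_set2 (etrans (esym ee) (etrans (congr1 _ e_e0) ee0)).
  by have := gv 0%N n; rewrite E distxx; lia.
by have := gv 0%N n.+1; rewrite E distxx; lia.
Qed.

End CountableTree.

(** * The Radon transform of summable functions *)

Section Radon.
Context {R : realType} {q : nat} {T : homogeneous_tree q}.
Implicit Types f : edge T -> R.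

Lemma esum_subset_fin_num f (h : set (edge T)) : (forall e, 0 <= f e) -> ell1 f ->
  (\esum_(e in h) (f e)%:E)%E \is a fin_num.
Proof.
move=> f0 fl; rewrite ge0_fin_numE; last by apply: esum_ge0 => e _; rewrite lee_fin.
apply: le_lt_trans fl; rewrite esum_mkcond; apply: le_esum => e _ /=.
by case: ifP => _ //; rewrite lee_fin ler_norm.
Qed.

(** The negative part contributes zero, and summability ensures that [fine] loses nothing. *)
Lemma ge0_radonE f h : (forall e, 0 <= f e) -> ell1 f ->
  (radon f h)%:E = (\esum_(e in h) (f e)%:E)%E.
Proof.
move=> f0 fl; rewrite /radon.
rewrite [X in (X - _)%E](_ : _ = \esum_(e in h) (f e)%:E)%E; last first.
  by apply: eq_esum => e _; rewrite funeposE/=; apply/max_idPl; rewrite lee_fin.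
rewrite [X in (_ - X)%E]esum1 ?sube0 ?fineK ?esum_subset_fin_num//.
by move=> e _; rewrite funenegE/=; apply/max_idPr; rewrite lee_fin oppr_le0.
Qed.

Lemma ell1_pos f : ell1 f -> ell1 (fun e => Num.max (f e) 0).
Proof.
move=> /summable_funepos; rewrite /ell1/=; congr summable; apply/funext => e.
by rewrite funeposE/= EFin_max.
Qed.

Lemma ell1_neg f : ell1 f -> ell1 (fun e => Num.max (- f e) 0).
Proof.
move=> /summable_funeneg; rewrite /ell1/=; congr summable; apply/funext => e.
by rewrite funenegE/= EFin_max.
Qed.

Lemma radon_posneg f h : ell1 f ->
  radon f h = radon (fun e => Num.max (f e) 0) h - radon (fun e => Num.max (- f e) 0) h.
Proof.
move=> fl; rewrite [LHS]/radon.
have -> : (\esum_(e in h) (EFin \o f)^\+ e)%E = (radon (fun e => Num.max (f e) 0) h)%:E.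
  rewrite ge0_radonE; [|by move=> e; rewrite le_max lexx orbT|exact: ell1_pos].
  by apply: eq_esum => e _; rewrite funeposE/= EFin_max.
have -> : (\esum_(e in h) (EFin \o f)^\- e)%E = (radon (fun e => Num.max (- f e) 0) h)%:E.
  rewrite ge0_radonE; [|by move=> e; rewrite le_max lexx orbT|exact: ell1_neg].
  by apply: eq_esum => e _; rewrite funenegE/= EFin_max.
by [].
Qed.

Lemma finitely_supported_ell1 : finitely_supported `<=` @ell1 q T R.
Proof.
move=> f ff; rewrite /ell1/= /summable.
rewrite (_ : \esum_(e in _) _ = \esum_(e in [set e | f e != 0%R]) `|(f e)%:E|)%E.
  rewrite esum_fset// fsbig_finite//=.
  by rewrite sumEFin ltry.
rewrite [RHS]esum_mkcond; apply: eq_esum => e _; case: ifPn => //= /negP ne.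
by have [->|h] := eqVneq (f e) 0; [rewrite normr0|case: ne; exact/mem_set].
Qed.
End Radon.

(** * Inversion from the vanishing of the means *)

Section Inversion.
Context {R : realType} {q : nat} {T : homogeneous_tree q}.
Variables (e0 : edge T) (nu : probability (end_borel T) R).
Hypothesis Hnu : is_end_measure e0 nu.

Let index_set e m : set (end_borel T) := [set w | edge_index e e0 w = m].

(** The mean of [c] at the index of [e], regrouped by the value of the index instead of the turn. *)
Lemma esum_edge_index e (c : int -> R) : (forall m, 0 <= c m) ->
  (\esum_(m in [set: int]) ((c m)%:E * nu (index_set e m)))%E =
  (turn_average q (edge_dist e0 e) c)%:E.
Proof.
move=> c0; have [n [v [gv ee0 ee]]] := geodesic_through_edges e0 e.
rewrite (edge_dist_geodesic gv ee0 ee) /turn_average -sumEFin.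
pose F (m : int) (k : 'I_n.+2) : \bar R :=
  if turn_index n k == m then (c m * turn_mass R q n k)%:E else 0%E.
have F0 m k : (0 <= F m k)%E.
  rewrite /F; case: ifP => // _; rewrite lee_fin mulr_ge0// turn_mass_ge0//.
  exact: (tree_degree_gt0 T).
rewrite (@eq_esum _ _ _ _ (fun m => \sum_(k < n.+2) F m k)%E); last first.
  move=> m _; rewrite /index_set (measure_edge_index Hnu m gv ee0 ee) -EFinM mulr_sumr.
  by rewrite -sumEFin big_mkcond.
rewrite esum_sum//; apply: eq_bigr => k _.
rewrite -(@esum_set1 _ _ (turn_index n k) (fun m => (c m * turn_mass R q n k)%:E)).
  rewrite [RHS]esum_mkcond; apply: eq_esum => m _; rewrite /F.
  rewrite (_ : (m \in [set turn_index n k]) = (turn_index n k == m))//.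
  by apply/idP/eqP => [/set_mem ->|->]//; exact/mem_set.
by rewrite lee_fin mulr_ge0// turn_mass_ge0// (tree_degree_gt0 T).
Qed.

Section Nonnegative.
Variable f : edge T -> R.
Hypotheses (f0 : forall e, 0 <= f e) (fl : ell1 f).

(** As a sum of indicators over the fixed set of all edges, the transform can be integrated term by
    term in [w]. *)
Lemma radon_horosphereE m w : (radon f (edge_horosphere m w e0))%:E =
  (\esum_(e in [set: edge T]) ((f e)%:E * (\1_(index_set e m) w)%:E))%E.
Proof.
rewrite ge0_radonE// esum_mkcond; apply: eq_esum => e _.
rewrite indicE (_ : (w \in index_set e m) = (e \in edge_horosphere m w e0)).
  by case: ifP => _; rewrite ?mule1 ?mule0.
by apply/idP/idP => /set_mem h; apply/mem_set.
Qed.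

Lemma measurable_radon m :
  measurable_fun [set: end_borel T] (fun w => (radon f (edge_horosphere m w e0))%:E).
Proof.
under eq_fun do rewrite radon_horosphereE.
apply: ge0_emeasurable_esum => [|e w|e]; first exact: countable_edges.
  by rewrite mule_ge0// lee_fin.
apply: measurable_funeM; apply/measurable_EFinP/measurable_indic.
exact: measurable_edge_index.
Qed.

Lemma integral_radon m : (\int[nu]_w (radon f (edge_horosphere m w e0))%:E)%E =
  (\esum_(e in [set: edge T]) ((f e)%:E * nu (index_set e m)))%E.
Proof.
under eq_integral do rewrite radon_horosphereE.
have mi e : measurable (index_set e m) by exact: measurable_edge_index.
rewrite ge0_integral_esum//.
- apply: eq_esum => e _; rewrite ge0_integralZl_EFin ?integral_indic ?setIT//.
  by apply/measurable_EFinP/measurable_indic.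
- exact: countable_edges.
- by move=> e w; rewrite mule_ge0// lee_fin.
- by move=> e; apply: measurable_funeM; apply/measurable_EFinP/measurable_indic.
Qed.

Lemma integral_radon_lty m : (\int[nu]_w (radon f (edge_horosphere m w e0))%:E < +oo)%E.
Proof.
rewrite integral_radon; apply: le_lt_trans fl; apply: le_esum => e _.
rewrite /= ger0_norm// -[leRHS]mule1 lee_wpmul2l ?lee_fin//.
exact: (probability_le1 nu (measurable_edge_index e0 e m)).
Qed.

Lemma integrable_radon m :
  nu.-integrable setT (fun w => (radon f (edge_horosphere m w e0))%:E).
Proof.
apply/integrableP; split; first exact: measurable_radon.
rewrite (eq_integral (fun w : end_borel T => (radon f (edge_horosphere m w e0))%:E)).
  exact: integral_radon_lty.
move=> w _; rewrite gee0_abs// ge0_radonE//; apply: esum_ge0 => e _.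
by rewrite lee_fin.
Qed.

Lemma horosphere_meanE m : (horosphere_mean e0 nu (radon f) m)%:E =
  (\esum_(e in [set: edge T]) ((f e)%:E * nu (index_set e m)))%E.
Proof.
rewrite -integral_radon /horosphere_mean /Rintegral fineK//.
exact: integrable_fin_num (integrable_radon m).
Qed.

(** Everything being nonnegative, the sums over indices and edges can be exchanged; the bound [C] on
    the means makes the total at most [C] times the norm of [f]. *)
Lemma bilateral_mean_ge0 (c : int -> R) C : (forall m, 0 <= c m) ->
  (forall n, turn_average q n c <= C) -> exists s,
  (\esum_(e in [set: edge T]) (f e * turn_average q (edge_dist e0 e) c)%:E = s%:E)%E /\
  bilateral_sum (fun m => c m * horosphere_mean e0 nu (radon f) m) s.
Proof.
move=> c0 cC; have C0 : 0 <= C.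
  by apply: le_trans (cC 0%N); rewrite turn_average0// (tree_degree_gt0 T).
have avg0 e : 0 <= turn_average q (edge_dist e0 e) c.
  rewrite /turn_average sumr_ge0// => k _; rewrite mulr_ge0// turn_mass_ge0//.
  exact: (tree_degree_gt0 T).
set S := (\esum_(e in _) _)%E.
have Sfin : S \is a fin_num.
  rewrite /S (esum_subset_fin_num
    (f := fun e => f e * turn_average q (edge_dist e0 e) c))//.
    by move=> e; rewrite mulr_ge0.
  rewrite /ell1/= /summable.
  apply: (@le_lt_trans _ _ (\esum_(e in [set: edge T]) (C%:E * `|(f e)%:E|))%E).
    apply: le_esum => e _ /=; rewrite ger0_norm ?mulr_ge0// ger0_norm//.
    by rewrite lee_fin mulrC ler_wpM2r.
  by rewrite esumZl// lte_mul_pinfty// ?lee_fin//; exact: fl.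
exists (fine S); rewrite fineK//; split => //; apply: bilateral_sum_esum.
  move=> m; rewrite mulr_ge0// -lee_fin horosphere_meanE; apply: esum_ge0 => e _.
  by rewrite mule_ge0// lee_fin.
rewrite fineK// /S.
rewrite (@eq_esum _ _ _ _ (fun m => \esum_(e in [set: edge T])
    ((c m)%:E * ((f e)%:E * nu (index_set e m))))%E); last first.
  move=> m _; rewrite EFinM horosphere_meanE esumZl// => e.
  by rewrite mule_ge0// lee_fin.
(* After the exchange, the inner sum over [m] is the mean of [c] for the edge [e]. *)
rewrite exchange_esum; last by move=> m e; rewrite !mule_ge0// lee_fin.
apply: eq_esum => e _; rewrite EFinM -esum_edge_index// -esumZl//; last first.
  by move=> m; rewrite mule_ge0// lee_fin.
by apply: eq_esum => m _; rewrite muleCA.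
Qed.

Lemma esum_base_edge :
  (\esum_(e in [set: edge T]) (f e * (edge_dist e0 e == 0%N)%:R)%:E = (f e0)%:E)%E.
Proof.
rewrite -(@esum_set1 _ _ e0 (fun e => (f e)%:E)) ?lee_fin//.
rewrite [RHS]esum_mkcond; apply: eq_esum => e _.
rewrite (_ : (e \in [set e0]) = (edge_dist e0 e == 0%N)).
  by case: eqP => _; rewrite ?mulr1 ?mulr0.
by apply/idP/eqP => [/set_mem|] /edge_dist_eq0// h; apply/mem_set.
Qed.

(** The positive and negative parts of [l] are handled separately: by comparison with the function
    [1 + q^m], of mean 2, their means are at most [2 C]. *)
Lemma inversion_ge0 (l : int -> R) C : (forall m, `|l m| <= C * (1 + q%:R ^ m)) ->
  (forall n, turn_average q n l = (n == 0%N)%:R) ->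
  formula_value e0 nu l (radon f) (f e0).
Proof.
move=> lC lavg; split; first exact: integrable_radon.
have q0 := tree_degree_gt0 T.
pose lp m := Num.max (l m) 0; pose lm m := Num.max (- l m) 0.
have lE m : l m = lp m - lm m.
  by rewrite /lp /lm; case: (leP (l m) 0); case: (leP (- l m) 0); lra.
have bound c : (forall m, c m <= `|l m|) -> forall n, turn_average q n c <= C * 2.
  move=> cl n; rewrite -(turn_average_poisson q0 n) -turn_averageZ.
  by apply: ler_turn_average => // m; exact: le_trans (cl m) (lC m).
have lp0 m : 0 <= lp m by rewrite le_max lexx orbT.
have lm0 m : 0 <= lm m by rewrite le_max lexx orbT.
have lpl m : lp m <= `|l m| by rewrite ge_max normr_ge0 ler_norm.
have lml m : lm m <= `|l m| by rewrite ge_max normr_ge0 -normrN ler_norm.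
have [sp [spE hp]] := bilateral_mean_ge0 lp0 (bound _ lpl).
have [sm [smE hm]] := bilateral_mean_ge0 lm0 (bound _ lml).
have -> : f e0 = sp - sm.
  (* Proved in the form [sp = f e0 + sm], where only nonnegative sums are added. *)
  apply/eqP; rewrite eq_sym subr_eq -eqe EFinD -spE -smE -esum_base_edge.
  rewrite -esumD.
  - apply/eqP/eq_esum => e _; rewrite -EFinD -mulrDr -lavg; congr (_ * _)%:E.
    by rewrite (_ : l = fun m => lp m - lm m) ?turn_averageB ?subrK//; apply/funext.
  - by move=> e _; rewrite lee_fin mulr_ge0.
  - move=> e _; rewrite lee_fin mulr_ge0// sumr_ge0// => k _.
    by rewrite mulr_ge0// turn_mass_ge0.
have := bilateral_sumB hp hm; congr bilateral_sum; apply/funext => m.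
by rewrite lE mulrBl.
Qed.

End Nonnegative.

(** By linearity, the nonnegative case is applied to both parts of [f]. *)
Lemma inversion_ell1 (l : int -> R) C : (forall m, `|l m| <= C * (1 + q%:R ^ m)) ->
  (forall n, turn_average q n l = (n == 0%N)%:R) -> inversion_formula ell1 e0 nu l.
Proof.
move=> lC lavg f fl.
have max0 g (e : edge T) : 0 <= Num.max (g e) 0 :> R by rewrite le_max lexx orbT.
have [ip hp] := inversion_ge0 (max0 _) (ell1_pos fl) lC lavg.
have [im hm] := inversion_ge0 (max0 _) (ell1_neg fl) lC lavg.
split.
  move=> m; have := integrableB measurableT (ip m) (im m).
  by apply: eq_integrable => // w _; rewrite (radon_posneg _ fl).
have := bilateral_sumB hp hm.
have -> : Num.max (f e0) 0 - Num.max (- f e0) 0 = f e0.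
  by case: (leP (f e0) 0); case: (leP (- f e0) 0); lra.
congr bilateral_sum; apply/funext => m; rewrite -mulrBr; congr (_ * _).
rewrite /horosphere_mean -RintegralB//; [|exact: ip|exact: im].
by apply: eq_Rintegral => w _; rewrite (radon_posneg _ fl).
Qed.

Lemma inversion_one_sided : inversion_formula ell1 e0 nu (coef_one_sided R q).
Proof.
have q0 := tree_degree_gt0 T.
apply: (inversion_ell1 (C := 1)) => [m|n]; last exact: turn_average_one_sided.
rewrite mul1r; case: m => [[|m]|m].
- by rewrite /coef_one_sided/= expr0z normr1 lerDl.
- rewrite /coef_one_sided/= -!exprnP normrM.
  (* The factor [(1 - q) / (1 + q)] has absolute value at most 1. *)
  apply: (@le_trans _ _ (1 * `|1 - (- q%:R) ^+ m.+1|)).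
    rewrite ler_wpM2r// ler_norml.
    have q1 : (1 : R) <= q%:R by rewrite ler1n.
    by rewrite ler_pdivlMr ?ler_pdivrMr; lra.
  by rewrite mul1r (le_trans (ler_normB _ _))// normr1 normrX normrN normr_nat.
- by rewrite /coef_one_sided/= normr0 addr_ge0// exprz_ge0.
Qed.

Lemma inversion_two_sided : inversion_formula ell1 e0 nu (coef_two_sided R q).
Proof.
have q0 := tree_degree_gt0 T.
apply: (inversion_ell1 (C := 2)) => [m|n]; last exact: turn_average_two_sided.
have le1 : (1 : R) <= 2 * (1 + q%:R ^ m).
  by have : 0 <= q%:R ^ m :> R by [exact: exprz_ge0]; lra.
rewrite /coef_two_sided; case: ifPn => [_|].
  suff -> : `|(-1) ^ m| = 1 :> R by [].
  case: m {le1} => m; rewrite ?NegzE -?exprnN -?exprnP ?normfV;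
    by rewrite normrX normrN1 expr1n ?invr1.
case: m le1 => [m|//] le1 _; rewrite -!exprnP.
apply: le_trans (ler_normB _ _) _; rewrite normr1 normrM normrM normfV.
rewrite [ `|2|]ger0_norm// [ `|1 + q%:R|]ger0_norm//.
have : `|1 - (- q%:R) ^+ m| <= 1 + q%:R ^+ m :> R.
  by rewrite (le_trans (ler_normB _ _))// normr1 normrX normrN normr_nat.
(* Since [q >= 1], the factor [2 / (1 + q)] is at most 1. *)
have : `|1 - (- q%:R) ^+ m| / (1 + q%:R) * 2 <= `|1 - (- q%:R) ^+ m| :> R.
  rewrite mulrAC ler_pdivrMr ?ltr_pwDl// ler_wpM2l//.
  by have : (1 : R) <= q%:R by [rewrite ler1n]; lra.
have : 0 <= q%:R ^+ m :> R by rewrite exprn_ge0.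
by rewrite [2 * ( `|_| / _)]mulrC; lra.
Qed.

End Inversion.

(** * Equivalence and uncountability of the inversion formulas *)

Lemma uncountable_reals (R : realType) : ~ countable [set: R].
Proof.
(* A countable set is Lebesgue null, whereas the unit interval has measure 1. *)
move=> cR; have c01 : countable (`[0, 1]%classic : set R).
  by apply: sub_countable cR; exact: subset_card_le.
have := countable_lebesgue_measure0 c01.
by rewrite lebesgue_measure_itv/= lte_fin ltr01 sube0 => /eqP; rewrite eqe oner_eq0.
Qed.

Section Formulas.
Context {R : realType} {q : nat} {T : homogeneous_tree q}.
Variables (e0 : edge T) (nu : probability (end_borel T) R).
Implicit Types (F : set (edge T -> R)) (l : int -> R).

Lemma inversion_formulaS F F' l : F `<=` F' ->
  inversion_formula F' e0 nu l -> inversion_formula F e0 nu l.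
Proof. by move=> FF' Hl f /FF'/Hl. Qed.

Lemma inversion_formula_affine F t l l' : inversion_formula F e0 nu l ->
  inversion_formula F e0 nu l' ->
  inversion_formula F e0 nu (fun n => t * l n + (1 - t) * l' n).
Proof.
move=> Hl Hl' f Ff; have [fi Sl] := Hl f Ff; have [_ Sl'] := Hl' f Ff.
split=> //.
have := bilateral_sumD (bilateral_sumZ t Sl) (bilateral_sumZ (1 - t) Sl').
rewrite -mulrDl addrCA subrr addr0 mul1r; congr bilateral_sum; apply/funext => n.
by rewrite [RHS]mulrDl -!mulrA.
Qed.

(** On the transform of [f] both formulas have the value [f e0], and no other since bilateral sums
    are unique. *)
Lemma inversion_formula_equivalent F l l' : inversion_formula F e0 nu l ->
  inversion_formula F e0 nu l' -> equivalent_formulas F e0 nu l l'.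
Proof.
move=> Hl Hl' psi s [f Ff <-]; have [fi Sl] := Hl f Ff; have [_ Sl'] := Hl' f Ff.
by split=> -[_ Ss]; split=> //;
  [rewrite (bilateral_sum_unique Ss Sl)|rewrite (bilateral_sum_unique Ss Sl')].
Qed.

(** The affine line through [l] and [l'] lies in the set, and its parameter can be read off from the
    coefficient [n]. *)
Lemma uncountable_inversion_formula F l l' n : l n <> l' n ->
  inversion_formula F e0 nu l -> inversion_formula F e0 nu l' ->
  ~ countable (inversion_formula F e0 nu).
Proof.
move=> ll' Hl Hl' cF; apply: (@uncountable_reals R).
have /countable_injP[g ginj] := cF.
apply/countable_injP.
exists (fun t => g (fun n => t * l n + (1 - t) * l' n)) => s t _ _.
have H r := mem_set (inversion_formula_affine r Hl Hl').
move=> /(ginj _ _ (H s) (H t))/(congr1 (@^~ n))/= E.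
have /eqP : (s - t) * (l n - l' n) = 0 by lra.
by rewrite mulf_eq0 !subr_eq0 => /orP[/eqP|/eqP /ll'].
Qed.

End Formulas.

Theorem corollary3p2p6 (R : realType) (q : nat) (T : homogeneous_tree q)
    (e0 : edge T) (nu : probability (end_borel T) R)
    (Hnu : is_end_measure e0 nu)
    (F : set (edge T -> R)) (HF : F = finitely_supported \/ F = ell1) :
  [/\ ~ countable (inversion_formula F e0 nu),
      forall l l', inversion_formula F e0 nu l ->
        inversion_formula F e0 nu l' -> equivalent_formulas F e0 nu l l',
      inversion_formula F e0 nu (coef_one_sided R q) &
      inversion_formula F e0 nu (coef_two_sided R q)].
Proof.
have Fl1 : F `<=` ell1 by case: HF => ->; [exact: finitely_supported_ell1|].
have H1 := inversion_formulaS Fl1 (inversion_one_sided Hnu).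
have H2 := inversion_formulaS Fl1 (inversion_two_sided Hnu).
split => //; last by move=> l l'; exact: inversion_formula_equivalent.
(* At index -1 the two examples are 0 and -1, hence distinct for every [q]. *)
apply: (uncountable_inversion_formula (n := -1) _ H1 H2).
rewrite /coef_one_sided /coef_two_sided/= exprN1 invrN1 => /eqP.
by rewrite eq_sym oppr_eq0 oner_eq0.
Qed.
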